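(* Let $\Omega$ be a bounded domain in $\mathbb{R}^n$ and let $u$ be a smooth function on $\overline{\Omega}$ with $|Du|<1$ on $\overline\Omega$ that solves $$\mathrm{div}\left(\frac{Du}{\sqrt{1-|Du|^2}}\right)=\frac{1}{\sqrt{1-|Du|^2}}$$ in $\overline\Omega$. Set $M=\{(x,u(x))\mid x\in\Omega\}$. Then for any bounded weakly spacelike hypersurface $\Sigma\subset\mathbb{R}^{n+1}_1$ with $\partial\Sigma=\partial M$ (that is, $\Sigma=\{(x,w(x))\mid x\in\Omega\}$ with $w\in\mathcal{C}(u,\Omega)$) one has $$\int_\Sigma e^{-x_{n+1}}\,dV_\Sigma\le\int_M e^{-x_{n+1}}\,dV_M,$$ with equality if and only if $\Sigma=M$.
   Context: Standing assumption: $n\ge2$. $\mathbb{R}^{n+1}_1$ is $\mathbb{R}^{n+1}$ with the Lorentz metric $\sum_{i=1}^n dx_i^2-dx_{n+1}^2$. A hypersurface $\{(x,w(x))\mid x\in\Omega\}$ is weakly spacelike if $w\in C^{0,1}(\Omega)$ (locally Lipschitz functions on $\Omega$) and $|Dw|\le1$ a.e. in $\Omega$. The set $\mathcal{C}(u,\Omega)$ consists of all $w\in C^{0,1}(\Omega)$ with $w=u$ on $\partial\Omega$ (continuously) and $|Dw|\le1$ a.e. in $\Omega$. The volume element of the graph of $w$ is $dV=\sqrt{1-|Dw|^2}\,dx$, so that $\int_\Sigma e^{-x_{n+1}}dV_\Sigma=\int_\Omega e^{-w}\sqrt{1-|Dw|^2}\,dx$, and similarly for $M$ with $u$ in place of $w$.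 *)

(* Defs.v *)
From HB Require Import structures.
From mathcomp Require Import all_boot all_order all_algebra.
From mathcomp Require Import all_classical all_reals all_analysis.

Set Implicit Arguments.
Unset Strict Implicit.
Unset Printing Implicit Defensive.

Import Order.TTheory GRing.Theory Num.Theory.
Import numFieldNormedType.Exports.

Local Open Scope classical_set_scope.
Local Open Scope ring_scope.

(* 'rV[R]_n carries the product sigma-algebra, i.e. the one generated by the
   coordinate functions; since R carries its Borel sets, this is the Borel
   sigma-algebra of R^n. *)
Definition rV_display : measure_display.
Proof. exact: default_measure_display. Qed.

Section measurable_rV.
Context {R : realType} {n : nat}.

Definition rV_coord (i : 'I_n) (x : 'rV[R]_n) : measurableTypeR R := x 0 i.

Let rV_set0 : g_sigma_preimage rV_coord set0.
Proof. exact: sigma_algebra0. Qed.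

Let rV_setC A : g_sigma_preimage rV_coord A -> g_sigma_preimage rV_coord (~` A).
Proof. exact: sigma_algebraC. Qed.

Let rV_bigcup (F : _^nat) : (forall i, g_sigma_preimage rV_coord (F i)) ->
  g_sigma_preimage rV_coord (\bigcup_i (F i)).
Proof. exact: sigma_algebra_bigcup. Qed.

HB.instance Definition _ := @isMeasurable.Build rV_display
  'rV[R]_n (g_sigma_preimage rV_coord) rV_set0 rV_setC rV_bigcup.

Lemma measurable_rV_coord (i : 'I_n) :
  measurable_fun [set: 'rV[R]_n] (rV_coord i).
Proof.
move=> _ Y mY; rewrite setTI; apply: sub_sigma_algebra => /=.
rewrite -bigcup_seq/=; exists i => /=; first by rewrite mem_index_enum.
by exists Y => //; rewrite setTI.
Qed.

Lemma measurable_fun_rV d (T : measurableType d) (f : T -> 'rV[R]_n) :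
  (forall i, measurable_fun [set: T] (rV_coord i \o f)) ->
  measurable_fun [set: T] f.
Proof.
move=> mf _ A mA; rewrite setTI.
have H : g_sigma_preimage (fun i => rV_coord i \o f) `<=` measurable.
  apply: smallest_sub; first exact: sigma_algebra_measurable.
  rewrite -bigcup_seq; apply: bigcup_sub => i _ B [C mC <-].
  exact: mf.
apply: H; rewrite g_sigma_preimage_comp; exists A => //.
by rewrite setTI.
Qed.

End measurable_rV.

Section lebesgue_rV.
Context {R : realType}.

Definition rV_cons n (p : measurableTypeR R * 'rV[R]_n) : 'rV[R]_n.+1 :=
  \row_i if unlift ord0 i is Some j then p.2 0 j else p.1.

Definition rV_uncons n (x : 'rV[R]_n.+1) : measurableTypeR R * 'rV[R]_n :=
  (x 0 ord0, \row_j x 0 (lift ord0 j)).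

Lemma rV_cons0 n p : @rV_cons n p 0 ord0 = p.1.
Proof. by rewrite mxE unlift_none. Qed.

Lemma rV_consS n p j : @rV_cons n p 0 (lift ord0 j) = p.2 0 j.
Proof. by rewrite mxE liftK. Qed.

Lemma rV_consK n : cancel (@rV_cons n) (@rV_uncons n).
Proof.
move=> [a y]; rewrite /rV_uncons rV_cons0; congr pair.
by apply/rowP => j; rewrite mxE rV_consS.
Qed.

Lemma measurable_rV_cons n : measurable_fun setT (@rV_cons n).
Proof.
apply: measurable_fun_rV => i; case: (unliftP ord0 i) => [j ->|->].
  rewrite (_ : _ \o _ = rV_coord j \o snd).
    by apply: measurableT_comp => //; exact: measurable_rV_coord.
  by apply/funext => p /=; rewrite /rV_coord rV_consS.
rewrite (_ : _ \o _ = fst); first exact: measurable_fst.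
by apply/funext => p /=; rewrite /rV_coord rV_cons0.
Qed.

Lemma measurable_rV_uncons n : measurable_fun setT (@rV_uncons n).
Proof.
apply/measurable_fun_pairP; split; first exact: measurable_rV_coord.
apply: measurable_fun_rV => j.
rewrite (_ : _ \o _ = rV_coord (lift ord0 j)); first exact: measurable_rV_coord.
by apply/funext => x /=; rewrite /rV_coord mxE.
Qed.

Section step.
Context {n : nat} (m : {sigma_finite_measure set 'rV[R]_n -> \bar R}).

Definition lebesgue_rV_step : set 'rV[R]_n.+1 -> \bar R :=
  pushforward (@lebesgue_measure R \x m)%E (@rV_cons n).

Let step0 : lebesgue_rV_step set0 = 0%E.
Proof. by rewrite /lebesgue_rV_step /pushforward preimage_set0 measure0. Qed.

Let step_ge0 A : (0 <= lebesgue_rV_step A)%E.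
Proof. exact: (measure_ge0 (@lebesgue_measure R \x m)%E). Qed.

Let step_sigma_additive : semi_sigma_additive lebesgue_rV_step.
Proof.
have mcons A : measurable A -> measurable (@rV_cons n @^-1` A).
  by move=> mA; rewrite -[X in measurable X]setTI; exact: measurable_rV_cons.
move=> F mF tF mUF; rewrite /lebesgue_rV_step /pushforward preimage_bigcup.
apply: (@measure_semi_sigma_additive _ _ _ (@lebesgue_measure R \x m)%E).
- by move=> k; exact: mcons.
- apply/trivIsetP => /= i j _ _ ij; rewrite -preimage_setI.
  by move/trivIsetP : tF => /(_ _ _ _ _ ij) ->//; rewrite preimage_set0.
- by rewrite -preimage_bigcup; exact: mcons.
Qed.

HB.instance Definition _ := isMeasure.Build _ _ _ lebesgue_rV_step
  step0 step_ge0 step_sigma_additive.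

Let step_sigma_finite : sigma_finite setT lebesgue_rV_step.
Proof.
have /sigma_finiteP[F [TF ndF Foo]] := sigma_finiteT (@lebesgue_measure R).
have /sigma_finiteP[G [TG ndG Goo]] := sigma_finiteT m.
exists (fun k => @rV_uncons n @^-1` (F k `*` G k)).
  apply/esym; rewrite -subTset => x _.
  have [i _ Fi] : (\bigcup_k F k) (rV_uncons x).1 by rewrite -TF.
  have [j _ Gj] : (\bigcup_k G k) (rV_uncons x).2 by rewrite -TG.
  exists (maxn i j) => //; split.
  - by move: Fi; exact/subsetPset/ndF/leq_maxl.
  - by move: Gj; exact/subsetPset/ndG/leq_maxr.
move=> k; have [mF Fk] := Foo k; have [mG Gk] := Goo k; split.
  rewrite -[X in measurable X]setTI; apply: measurable_rV_uncons => //.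
  exact: measurableX.
rewrite /lebesgue_rV_step /pushforward -comp_preimage.
rewrite (_ : _ \o _ = id) ?preimage_id; last by apply/funext => p; exact: rV_consK.
by rewrite product_measure1E// lte_mul_pinfty// ge0_fin_numE.
Qed.

HB.instance Definition _ := Measure_isSigmaFinite.Build _ _ _
  lebesgue_rV_step step_sigma_finite.

End step.

(* n-dimensional Lebesgue measure: the image of the product of the
   one-dimensional and the (n-1)-dimensional ones under R x R^(n-1) = R^n. *)
Fixpoint lebesgue_rV n : {sigma_finite_measure set 'rV[R]_n -> \bar R} :=
  if n is k.+1 then lebesgue_rV_step (lebesgue_rV k) else \d_(0 : 'rV[R]_0).

Lemma lebesgue_rV_box n (a b : 'rV[R]_n) :
  (forall i, a 0 i <= b 0 i) ->
  lebesgue_rV n [set x : 'rV[R]_n | forall i, x 0 i \in `[a 0 i, b 0 i]] =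
  (\prod_i (b 0 i - a 0 i))%:E.
Proof.
elim: n a b => [|n IH] a b ab.
  rewrite big_ord0 /= diracE mem_set//=; by case.
pose a' := \row_j a 0 (lift ord0 j); pose b' := \row_j b 0 (lift ord0 j).
set A := [set x : 'rV[R]_n.+1 | forall i, x 0 i \in `[a 0 i, b 0 i]].
have -> : lebesgue_rV n.+1 A = (@lebesgue_measure R \x lebesgue_rV n)%E (@rV_cons n @^-1` A) by [].
have -> : @rV_cons n @^-1` A = `[a 0 ord0, b 0 ord0]%classic `*`
  [set y : 'rV[R]_n | forall j, y 0 j \in `[a' 0 j, b' 0 j]].
  apply/seteqP; split => -[t y]/=.
    move=> h; split; first by have := h ord0; rewrite rV_cons0.
    by move=> j; rewrite /a' /b' !mxE; have := h (lift ord0 j); rewrite rV_consS.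
  move=> [h1 h2] i; case: (unliftP ord0 i) => [j ->|->]; last by rewrite rV_cons0.
  by rewrite rV_consS; have := h2 j; rewrite /a' /b' !mxE.
rewrite product_measure1E//; last first.
  rewrite [X in measurable X](_ : _ = \bigcap_(j in [set: 'I_n]) (rV_coord j @^-1` `[a' 0 j, b' 0 j]%classic)).
    apply: fin_bigcap_measurable => // j _; rewrite -[X in measurable X]setTI.
    exact: measurable_rV_coord.
  by apply/seteqP; split => y /= h j; [move=> _; exact: h| exact: h].
have step : lebesgue_measure `[a 0 ord0, b 0 ord0]%classic = (b 0 ord0 - a 0 ord0)%:E.
  rewrite lebesgue_measure_itv/= lte_fin; case: ltP => // ba.
  by rewrite (@le_anti _ _ (a 0 ord0) (b 0 ord0)) ?ab ?subrr.
have R2 : lebesgue_rV n [set y : 'rV[R]_n | forall j, y 0 j \in `[a' 0 j, b' 0 j]] = (\prod_i (b' 0 i - a' 0 i))%:E.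
  by apply: IH => i; rewrite /a' /b' !mxE.
transitivity ((b 0 ord0 - a 0 ord0)%:E * (\prod_i (b' 0 i - a' 0 i))%:E)%E.
  by congr (_ * _)%E; [exact: step|exact: R2].
rewrite -EFinM big_ord_recl; congr (_ * _)%:E.
by apply: eq_bigr => j _; rewrite /a' /b' !mxE.
Qed.

End lebesgue_rV.

Section calculus.
Context {R : realType} {n : nat}.
Implicit Types (Omega : set 'rV[R]_n) (u w : 'rV[R]_n -> R) (x : 'rV[R]_n).

(* The library norm on 'rV[R]_n is the sup norm (it yields the usual topology,
   bounded sets and Lipschitz functions); lengths of gradients are Euclidean. *)
Definition euclid_norm (v : 'rV[R]_n) : R := Num.sqrt (\sum_i v 0 i ^+ 2).

Definition partial (i : 'I_n) u : 'rV[R]_n -> R := 'D_(delta_mx 0 i) u.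

Definition grad u x : 'rV[R]_n := \row_i partial i u x.

Definition divergence (V : 'rV[R]_n -> 'rV[R]_n) x : R :=
  \sum_i partial i (fun y => V y 0 i) x.

Definition bounded_domain Omega :=
  [/\ open Omega, connected Omega, Omega !=set0 & bounded_set Omega].

(* This is the topological boundary when Omega is open. *)
Definition bdry Omega : set 'rV[R]_n := closure Omega `\` Omega.

(* A function defined on Omega, continuously extended to the closure. *)
Definition extension (T : ptopologicalType) Omega (f : 'rV[R]_n -> T) :
    'rV[R]_n -> T :=
  patch (fun x => lim (f y @[y --> within Omega (nbhs x)])) Omega f.

(* u is in C^infty(closure Omega): all iterated partial derivatives exist in
   Omega (and are again differentiable, hence continuous), and extend
   continuously to the closure; u itself is its own continuous extension. *)
Definition smooth_on_closure Omega u :=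
  [/\ forall (s : seq 'I_n) x, Omega x -> differentiable (foldr partial u s) x,
      forall (s : seq 'I_n) x, bdry Omega x ->
        cvg (foldr partial u s y @[y --> within Omega (nbhs x)])
    & forall x, bdry Omega x -> u y @[y --> within Omega (nbhs x)] --> u x].

(* The values that 'D takes where w is not differentiable are irrelevant: w is
   locally Lipschitz, so these points form a null set (Rademacher). *)
Definition weakly_spacelike Omega w :=
  [locally [lipschitz (w x : R^o) | x in Omega]] /\
  {ae lebesgue_rV n, forall x, Omega x -> euclid_norm (grad w x) <= 1}.

(* The class C(u, Omega). *)
Definition admissible u Omega w :=
  weakly_spacelike Omega w /\
  forall x, bdry Omega x -> w y @[y --> within Omega (nbhs x)] --> u x.

Definition graph Omega w : set ('rV[R]_n * R) :=
  [set p | Omega p.1 /\ p.2 = w p.1].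

(* \int_S e^{- x_{n+1}} dV_S for S the graph of w over Omega. *)
Definition weighted_volume Omega w : \bar R :=
  (\int[lebesgue_rV n]_(x in Omega)
     (expR (- w x) * Num.sqrt (1 - euclid_norm (grad w x) ^+ 2))%:E)%E.

End calculus.

(* Main.v *)
Require Import Defs.
From HB Require Import structures.
From mathcomp Require Import all_boot all_order all_algebra.
From mathcomp Require Import all_classical all_reals all_analysis.
From mathcomp Require Import measurable_realfun.
From mathcomp Require Import ring lra.

(** The solution u calibrates its weighted volume. Put
    V = Du / sqrt(1 - |Du|^2) and eta = e^-w - e^-u. The equation says that
    div V = 1 / sqrt(1 - |Du|^2), so that almost everywhere
      div(eta V) = e^-w (1 - Dw.Du) / sqrt(1 - |Du|^2)
                   - e^-u sqrt(1 - |Du|^2).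
    With a = sqrt(1 - |Dw|^2) and b = sqrt(1 - |Du|^2), the inequality
    a b <= (a^2 + b^2) / 2 reads a b + |Dw - Du|^2 / 2 <= 1 - Dw.Du, which is
    the reverse Cauchy-Schwarz inequality [reverse_cauchy_schwarz] with a
    defect. Hence the density of w exceeds that of u by at most div(eta V),
    and the gap is at least a positive multiple of |Dw - Du|^2. As eta vanishes
    on the boundary, the integral of div(eta V) is 0 [calibration_flux], and the
    two volumes compare. If they are equal then Dw = Du almost everywhere, and
    the integral of div((w - u)^2 x_1 e_1) = (w - u)^2 is 0 as well, whence
    w = u [vanishing_gradient].

    Everything rests on the divergence theorem [integral_divergence] for eta V,
    where eta is locally Lipschitz and tends to 0 at the boundary of a bounded
    open set without any regularity. Truncating eta near 0 gives fields of
    compact support, which are Lipschitz on R^n after extension by 0; there the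
    integral of a partial derivative vanishes by Fubini and the one-dimensional
    fundamental theorem of calculus [lipschitz_FTC]. The truncations are undone
    by dominated convergence, because Dw is bounded almost everywhere.

    Only partial derivatives enter, so the differentiability theorem that is
    used is Rademacher's theorem along coordinate lines
    [lipschitz_derivable_null, loclip_derivable_ae]: a Lipschitz function of one
    variable differs by a linear function from a nondecreasing one, whose
    Stieltjes measure has a density with respect to Lebesgue measure, and the
    Lebesgue differentiation theorem identifies this density with the
    derivative; in R^n one slices, the exceptional sets being Borel
    [measurable_derivable]. The chain rule for truncations only needs that a
    derivative vanishes at a minimum [derive_at_min, derive_max0]. *)

Import Order.TTheory GRing.Theory Num.Theory.
Import numFieldNormedType.Exports.

Local Open Scope classical_set_scope.
Local Open Scope ring_scope.

Set Implicit Arguments.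
Unset Strict Implicit.
Unset Printing Implicit Defensive.

(** * Locally Lipschitz functions *)

Section local_lipschitz.
Context {R : realType} {V : normedModType R}.
Implicit Types (f g : V -> R) (x y z : V).

(** The pointwise form makes sums, products and compositions independent of
    the set on which a function is studied. *)
Definition loclip_at f x := exists L : R, exists2 U : set V, nbhs x U &
  forall y z, U y -> U z -> `|f y - f z| <= L * `|y - z|.

Lemma loclip_pos f x : loclip_at f x -> exists2 L : R, 0 < L &
  exists2 U : set V, nbhs x U &
    forall y z, U y -> U z -> `|f y - f z| <= L * `|y - z|.
Proof.
move=> [L [U xU fL]]; exists (Num.max L 1); first by rewrite lt_max ltr01 orbT.
exists U => // y z Uy Uz; apply: le_trans (fL _ _ Uy Uz) _.
by apply: ler_wpM2r => //; rewrite le_max lexx.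
Qed.

Lemma loclip_continuous f x : loclip_at f x -> {for x, continuous f}.
Proof.
move=> /loclip_pos[L L0 [U xU fL]]; apply/cvgrPdist_lt => e e0.
near=> y; apply: le_lt_trans (fL _ _ _ _) _; first exact: nbhs_singleton.
  by near: y.
rewrite -ltr_pdivlMl// distrC mulrC; near: y.
apply/nbhs_normP; exists (e / L) => /=; first by rewrite divr_gt0.
by move=> y /=; rewrite distrC.
Unshelve. all: by end_near. Qed.

Lemma near_eq_loclip f g x : (\forall y \near x, f y = g y) ->
  loclip_at f x -> loclip_at g x.
Proof.
move=> fg [L [U xU fL]]; exists L, (U `&` [set y | f y = g y]).
  exact: filterI.
by move=> y z [Uy /= <-] [Uz <-]; exact: fL.
Qed.

Lemma loclip_cst (c : R) x : loclip_at (cst c) x.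
Proof.
by exists 0, setT; [exact: filterT|move=> y z _ _; rewrite subrr normr0 mul0r].
Qed.

Lemma loclipN f x : loclip_at f x -> loclip_at (fun y => - f y) x.
Proof.
move=> [L [U xU fL]]; exists L, U => // y z Uy Uz.
by rewrite -opprD normrN; exact: fL.
Qed.

Lemma loclipD f g x : loclip_at f x -> loclip_at g x ->
  loclip_at (fun y => f y + g y) x.
Proof.
move=> [L [U xU fL]] [K [W xW gK]]; exists (L + K), (U `&` W).
  exact: filterI.
move=> y z [Uy Wy] [Uz Wz]; rewrite opprD addrACA mulrDl.
by rewrite (le_trans (ler_normD _ _))// lerD// ?fL ?gK.
Qed.

Lemma loclipB f g x : loclip_at f x -> loclip_at g x ->
  loclip_at (fun y => f y - g y) x.
Proof. by move=> fx gx; apply: loclipD => //; exact: loclipN. Qed.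

Lemma loclip_bounded f x : loclip_at f x ->
  exists M : R, \forall y \near x, `|f y| <= M.
Proof.
move=> /loclip_continuous fx; exists (`|f x| + 1).
have /cvgrPdist_lt/(_ _ ltr01) := fx.
apply: filterS => y fy; rewrite -lerBlDl.
by apply: le_trans (ltW fy); rewrite distrC lerB_dist.
Qed.

Lemma loclipM f g x : loclip_at f x -> loclip_at g x ->
  loclip_at (fun y => f y * g y) x.
Proof.
move=> fx gx.
have [M xM] := loclip_bounded fx; have [M' xM'] := loclip_bounded gx.
have [L L0 [U xU fL]] := loclip_pos fx; have [K K0 [W xW gK]] := loclip_pos gx.
exists (M * K + M' * L).
exists ((U `&` W) `&` ([set y | `|f y| <= M] `&` [set y | `|g y| <= M'])).
  by apply: filterI; apply: filterI.
move=> y z [[Uy Wy] [/= fy gy]] [[Uz Wz] [/= fz gz]].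
have -> : f y * g y - f z * g z = f y * (g y - g z) + g z * (f y - f z) by ring.
rewrite (le_trans (ler_normD _ _))// !normrM mulrDl -!mulrA.
by rewrite lerD// ler_pM// ?gK ?fL.
Qed.

Lemma loclip_sum (I : Type) (s : seq I) (F : I -> V -> R) x :
  (forall i, loclip_at (F i) x) -> loclip_at (fun y => \sum_(i <- s) F i y) x.
Proof.
move=> Fx; elim: s => [|i s IH].
  apply: near_eq_loclip (loclip_cst 0 x); apply: nearW => y /=.
  by rewrite big_nil.
apply: near_eq_loclip (loclipD (Fx i) IH); apply: nearW => y /=.
by rewrite big_cons.
Qed.

End local_lipschitz.

Section local_lipschitz_comp.
Context {R : realType} {V : normedModType R}.

Lemma loclip_comp (h : R -> R) (f : V -> R) (x : V) : loclip_at h (f x) -> loclip_at f x ->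
  loclip_at (fun y => h (f y)) x.
Proof.
move=> /loclip_pos[L L0 [U xU hL]] fx.
have /loclip_pos[K K0 [W xW fK]] := fx.
exists (L * K), (W `&` f @^-1` U).
  by apply: filterI => //; exact: (loclip_continuous fx).
move=> y z [Wy Uy] [Wz Uz]; apply: le_trans (hL _ _ Uy Uz) _.
by rewrite -mulrA ler_pM2l//; exact: fK.
Qed.

Lemma loclip_max0 (s : R) : loclip_at (fun t : R => Num.max t 0) s.
Proof.
exists 1, setT; first exact: filterT.
move=> y z _ _; rewrite mul1r.
have := ler_norm (y - z); have := ler_norm (z - y); rewrite (distrC z).
have := normr_ge0 (y - z); rewrite ler_norml.
by have [hy|hy] := leP y 0; have [hz|hz] := leP z 0; lra.
Qed.

Lemma loclip_expR (s : R) : loclip_at (@expR R) s.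
Proof.
exists (expR (s + 1)), (ball s 1); first exact: nbhsx_ballx.
suff H y z : y <= z -> z < s + 1 ->
    `|expR y - expR z| <= expR (s + 1) * `|y - z|.
  move=> y z; rewrite -!ball_normE /= !ltr_norml => sy sz.
  have [yz|/ltW zy] := leP y z; first by apply: H => //; lra.
  by rewrite distrC (distrC y); apply: H => //; lra.
move=> yz zs; rewrite (distrC (expR y)) ger0_norm ?subr_ge0 ?ler_expR//.
rewrite (distrC y) ger0_norm ?subr_ge0//.
have -> : expR z - expR y = expR z * (1 - expR (y - z)).
  by rewrite mulrBr mulr1 -expRD (_ : z + (y - z) = y)//; ring.
apply: ler_pM; first exact: expR_ge0.
- by rewrite subr_ge0 -[leRHS]expR0 ler_expR subr_le0.
- by rewrite ler_expR ltW.
- by have := expR_ge1Dx (y - z); lra.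
Qed.

Lemma loclip_invsqrt (s : R) : 0 < s ->
  loclip_at (fun t : R => (Num.sqrt t)^-1) s.
Proof.
move=> s0; pose c := Num.sqrt (s / 2).
have c0 : 0 < c by rewrite sqrtr_gt0 divr_gt0.
have s2 : 0 < s / 2 by rewrite divr_gt0.
exists (c ^- 3), (ball s (s / 2)); first exact: nbhsx_ballx.
move=> y z; rewrite -!ball_normE /= !ltr_norml => sy sz.
have cy : c <= Num.sqrt y by rewrite ler_sqrt; lra.
have cz : c <= Num.sqrt z by rewrite ler_sqrt; lra.
have y0 : 0 < Num.sqrt y by exact: lt_le_trans cy.
have z0 : 0 < Num.sqrt z by exact: lt_le_trans cz.
have yE : Num.sqrt y ^+ 2 = y by rewrite sqr_sqrtr//; lra.
have zE : Num.sqrt z ^+ 2 = z by rewrite sqr_sqrtr//; lra.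
set a := Num.sqrt y in cy y0 yE *; set b := Num.sqrt z in cz z0 zE *.
have -> : y - z = (a - b) * (a + b) by rewrite -yE -zE; ring.
have -> : a^-1 - b^-1 = (b - a) / (a * b) by field; rewrite !gt_eqF.
rewrite 2!normrM (distrC b) [in leRHS]mulrCA ler_wpM2l//.
have ab0 : 0 < a * b by exact: mulr_gt0.
have ab1 : 0 < a + b by exact: addr_gt0.
rewrite ger0_norm; last by rewrite invr_ge0 ltW.
rewrite (@ger0_norm _ (a + b)); last exact: ltW.
have c3 : 0 < c ^+ 3 by rewrite exprn_gt0.
rewrite (mulrC (c ^- 3)) ler_pdivlMr// [leLHS]mulrC ler_pdivrMr//.
have -> : c ^+ 3 = c * (c * c) by rewrite exprS expr2.
apply: ler_pM; rewrite ?mulr_ge0//; try exact: ltW.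
  by apply: le_trans cy _; rewrite lerDl ltW.
by apply: ler_pM => //; exact: ltW.
Qed.

End local_lipschitz_comp.

(** * Directional derivatives and the mean value inequality *)

Section directional.
Context {R : realType} {V : normedModType R}.
Implicit Types (f g : V -> R) (a x v : V).

Lemma line_quotient f a v (t : R) :
  (fun h : R => h^-1 *: (((fun s => f (a + s *: v)) \o shift t) (h *: (1 : R))
     - f (a + t *: v))) =
  (fun h => h^-1 *: ((f \o shift (a + t *: v)) (h *: v) - f (a + t *: v))).
Proof.
apply/funext => h /=; congr (_ *: (f _ - _)).
by rewrite scalerDl [_ *: 1]mulr1 addrCA.
Qed.

(** Directional derivatives are derivatives of restrictions to lines, by
    definition of the difference quotients; this also holds for the default
    value taken where the derivative does not exist. *)
Lemma derivable_line f a v (t : R) :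
  derivable (fun s : R => f (a + s *: v)) t 1 = derivable f (a + t *: v) v.
Proof. by rewrite /derivable line_quotient. Qed.

Lemma derive_line f a v (t : R) :
  'D_1 (fun s : R => f (a + s *: v)) t = 'D_v f (a + t *: v).
Proof. by rewrite /derive line_quotient. Qed.

Lemma is_derive_line f a v (t df : R) : is_derive (a + t *: v) v f df ->
  is_derive t 1 (fun s : R => f (a + s *: v)) df.
Proof.
by move=> [fd fE]; apply: DeriveDef; rewrite ?derivable_line ?derive_line.
Qed.

(** Along the line through x with direction v, this is the chain rule of one
    variable. *)
Lemma is_derive_compR (h : R -> R) f x v (dh df : R) :
  is_derive (f x) 1 h dh -> is_derive x v f df ->
  is_derive x v (fun y => h (f y)) (dh * df).
Proof.
rewrite -{1 2}[x]addr0 -(scale0r v) => hd fd.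
have /(is_derive1_comp hd)[hfd hfE] := is_derive_line fd.
rewrite -[x]addr0 -(scale0r v); apply: DeriveDef.
  by rewrite -derivable_line.
by rewrite -derive_line.
Qed.

(** At a minimum point the difference quotients of the two sides have opposite
    signs, so that any derivative vanishes. *)
Lemma derive_at_min f x v : derivable f x v -> (forall y, f x <= f y) ->
  'D_v f x = 0.
Proof.
move=> fd fmin; apply/eqP; rewrite eq_le; apply/andP; split.
  have dl : h^-1 *: ((f \o shift x) (h *: v) - f x) @[h --> 0^'-] --> 'D_v f x.
    exact: cvg_dnbhs_at_left.
  have <- := cvg_lim _ dl; last exact: Rhausdorff.
  apply: limr_le; first by apply/cvg_ex; exists ('D_v f x).
  near=> h; rewrite /= mulr_le0_ge0 ?invr_le0 ?subr_ge0//.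
have dr : h^-1 *: ((f \o shift x) (h *: v) - f x) @[h --> 0^'+] --> 'D_v f x.
  exact: cvg_dnbhs_at_right.
have <- := cvg_lim _ dr; last exact: Rhausdorff.
apply: limr_ge; first by apply/cvg_ex; exists ('D_v f x).
near=> h; rewrite /= mulr_ge0 ?invr_ge0 ?subr_ge0//.
Unshelve. all: by end_near. Qed.

End directional.

Section positive_part.
Context {R : realType} {V : normedModType R}.
Implicit Types (f g : V -> R) (x v : V).

(** Only the one-dimensional derivative along v of both f and its positive part
    is needed: where f vanishes, the positive part is minimal. *)
Lemma derive_max0 f x v : {for x, continuous f} ->
  derivable f x v -> derivable (fun y => Num.max (f y) 0) x v ->
  'D_v (fun y => Num.max (f y) 0) x = if 0 < f x then 'D_v f x else 0.
Proof.
move=> fx fd pd; case: ltgtP => fx0.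
- apply: near_eq_derive; near=> y; apply/max_idPl/ltW; near: y.
  exact: (cvgr_gt _ fx).
- transitivity ('D_v (cst (0 : R)) x); last exact: derive_cst.
  apply: near_eq_derive.
  near=> y; apply/max_idPr/ltW; near: y.
  exact: (cvgr_lt _ fx).
- apply: derive_at_min => // y; rewrite -fx0 maxxx.
  by rewrite le_max lexx orbT.
Unshelve. all: by end_near. Qed.

End positive_part.

Section continuously_differentiable.
Context {R : realType} {n : nat}.
Implicit Types (f : 'rV[R]_n -> R) (x y z v : 'rV[R]_n).

Lemma normr_coord v (i : 'I_n) : `|v 0 i| <= `|v|.
Proof.
rewrite [leRHS]/Num.norm /= mx_normrE.
by apply: (le_trans _ (le_bigmax _ _ (ord0, i))).
Qed.

Lemma derive_grad f x v : differentiable f x ->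
  'D_v f x = \sum_i v 0 i * partial i f x.
Proof.
move=> fx; rewrite deriveE// {1}[v]row_sum_delta linear_sum.
by apply: eq_bigr => i _; rewrite linearZ /= /partial deriveE.
Qed.

(** The mean value inequality on the convex ball where the partial derivatives
    stay bounded. *)
Lemma C1_loclip (Omega : set 'rV[R]_n) f x : open Omega ->
  (forall y, Omega y -> differentiable f y) ->
  (forall i y, Omega y -> {for y, continuous (partial i f)}) ->
  Omega x -> loclip_at f x.
Proof.
move=> oO df cf Ox.
pose M i := `|partial i f x| + 1.
have : \forall y \near x, Omega y /\ forall i, `|partial i f y| <= M i.
  suff /filter_forall H i : \forall y \near x, `|partial i f y| <= M i.
    exact: filterS2 (open_nbhs_nbhs (conj oO Ox)) H.
  have /cvgrPdist_lt/(_ _ ltr01) := cf i x Ox.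
  apply: filterS => y fy; rewrite -lerBlDl.
  by apply: le_trans (ltW fy); rewrite distrC lerB_dist.
move=> /nbhs_ballP[e /= e0 eP].
exists (\sum_i M i), (ball x e); first exact: nbhsx_ballx.
move=> y z; rewrite -ball_normE /= => xy xz.
have seg (t : R) : 0 <= t <= 1 -> ball x e (z + t *: (y - z)).
  move=> /andP[t0 t1]; rewrite -ball_normE /=.
  have -> : x - (z + t *: (y - z)) = t *: (x - y) + (1 - t) *: (x - z).
    by apply/rowP => i; rewrite !mxE; ring.
  apply: le_lt_trans (ler_normD _ _) _; rewrite !normrZ !ger0_norm ?subr_ge0//.
  have [->|tn0] := eqVneq t 0; first by rewrite mul0r add0r subr0 mul1r.
  have t0' : 0 < t by rewrite lt_neqAle eq_sym tn0.
  rewrite [ltRHS](_ : e = t * e + (1 - t) * e); last by ring.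
  apply: ltr_leD; first by rewrite ltr_pM2l.
  by rewrite ler_wpM2l ?subr_ge0// ltW.
pose phi (t : R) := f (z + t *: (y - z)).
have dphi (t : R) : 0 <= t <= 1 ->
    is_derive t 1 phi ('D_(y - z) f (z + t *: (y - z))).
  move=> t01; apply: is_derive_line; apply/derivableP/diff_derivable/df.
  by have [] := eP _ (seg t t01).
have [||c c01] := @MVT_segment _ phi
  (fun t => 'D_(y - z) f (z + t *: (y - z))) 0 1 ler01.
- by move=> t; rewrite in_itv /= => /andP[t0 t1]; apply: dphi; rewrite !ltW.
- apply: derivable_within_continuous => t; rewrite in_itv /= => t01.
  by have [] := dphi _ t01.
rewrite /phi scale0r scale1r addr0 (addrC z) subrK subr0 mulr1 => ->.
have {}c01 : 0 <= c <= 1 by rewrite in_itv in c01.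
have [Oc Mc] := eP _ (seg c c01).
rewrite derive_grad; last exact: df.
apply: le_trans (ler_norm_sum _ _ _) _; rewrite mulr_suml.
apply: ler_sum => i _; rewrite normrM mulrC.
by apply: ler_pM => //; exact: normr_coord.
Qed.

(** A compactness argument: the failure of a Lipschitz bound with constant k on
    pairs at distance below 1/k cannot persist for all k, and on pairs that are
    further apart the oscillation of the bounded function f is enough. *)
Lemma loclip_compact_lipschitz f (r : R) : (forall x, loclip_at f x) ->
  (forall x, r <= `|x| -> f x = 0) ->
  exists L : R, forall x y, `|f x - f y| <= L * `|x - y|.
Proof.
move=> fl f0; pose K : set 'rV[R]_n := [set x | `|x| <= r].
have cK : compact K.
  apply: bounded_closed_compact.
    exists r; split; first exact: num_real.
    by move=> s rs x /= xr; apply: le_trans xr (ltW rs).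
  rewrite (_ : K = (fun x => `|x|) @^-1` [set s : R | s <= r])//.
  by apply: closed_comp => [x _|]; [exact: norm_continuous|exact: closed_le].
have /compact_near_coveringP/(_ _ (+oo : set_system R)
  (fun k x => `|f x| <= k /\ forall y, `|x - y| < k^-1 ->
     `|f x - f y| <= k * `|x - y|)) cov := cK.
have {cov} : \forall k \near +oo, K `<=` (fun x => `|f x| <= k /\
    forall y, `|x - y| < k^-1 -> `|f x - f y| <= k * `|x - y|).
  apply: cov => x _.
  have [L L0 [U xU fL]] := loclip_pos (fl x).
  have [M fM] := loclip_bounded (fl x).
  have /nbhs_ballP[e /= e0 eU] := xU.
  near=> y k => /=; split.
    apply: (@le_trans _ _ M); first by near: y.
    by near: k; apply: nbhs_pinfty_ge; exact: num_real.
  move=> z yz; apply: le_trans (fL _ _ _ _) _.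
  - by near: y.
  - apply: eU; rewrite -ball_normE /=.
    rewrite (le_lt_trans (ler_distD y _ _))// [ltRHS](splitr e) ltrD//.
      by near: y; apply: cvgr_dist_lt; rewrite ?divr_gt0//; exact: cvg_id.
    apply: lt_le_trans yz _.
    have k0 : 0 < k by near: k; apply: nbhs_pinfty_gt; exact: num_real.
    have ek : (e / 2)^-1 <= k.
      by near: k; apply: nbhs_pinfty_ge; exact: num_real.
    by rewrite -[leRHS]invrK lef_pV2 ?posrE ?invr_gt0 ?divr_gt0.
  - exact: ler_wpM2r.
move=> /(filterI (nbhs_pinfty_gt (num_real 0)))[N [_ NP]].
have [|k0 kP] := NP (N + 1); first by rewrite ltrDl.
set k := N + 1 in k0 kP.
have fk x : `|f x| <= k.
  have [/ltW xr|xr] := ltP `|x| r; first by have [] := kP x xr.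
  by rewrite f0// normr0 ltW.
have H x y : K x -> `|f x - f y| <= (k + 2 * k * k) * `|x - y|.
  move=> Kx; have [xy|xy] := ltP `|x - y| k^-1.
    apply: le_trans ((kP x Kx).2 y xy) _; apply: ler_wpM2r => //.
    by rewrite lerDl !mulr_ge0// ltW.
  apply: (@le_trans _ _ (2 * k)).
    by apply: le_trans (ler_normB _ _) _; rewrite mulrDl mul1r lerD.
  rewrite [leRHS]mulrDl; apply: (@le_trans _ _ (2 * k * k * `|x - y|)); last first.
    by rewrite lerDr mulr_ge0// ltW.
  rewrite -[leLHS]mulr1 -!mulrA ler_pM2l// ler_pM2l//.
  by rewrite -ler_pdivrMl// mulr1.
exists (k + 2 * k * k) => x y.
have [Kx|xr] := leP `|x| r; first exact: H.
have [Ky|yr] := leP `|y| r; first by rewrite distrC (distrC x); exact: H.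
rewrite (f0 x (ltW xr)) (f0 y (ltW yr)) subrr normr0 mulr_ge0//.
by rewrite addr_ge0 ?mulr_ge0// ltW.
Unshelve. all: by end_near. Qed.

End continuously_differentiable.

(** * The fundamental theorem of calculus for Lipschitz functions of one variable *)

Lemma bounded_integrable d (T : measurableType d) (R : realType)
    (mu : {measure set T -> \bar R}) (A : set T) (f : T -> R) (M : R) :
  measurable A -> (mu A < +oo)%E -> measurable_fun A f ->
  (forall x, A x -> `|f x| <= M) -> mu.-integrable A (EFin \o f).
Proof.
move=> mA Aoo mf fM; apply: measurable_bounded_integrable => //.
exists M; split; first exact: num_real.
by move=> N MN x Ax; apply: le_trans (fM _ Ax) (ltW MN).
Qed.

Section lipschitz_real_line.
Context {R : realType}.
Notation leb := (@lebesgue_measure R).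

(** Covers by half-open intervals compare the two outer measures directly. *)
Lemma le_lebesgue_stieltjes (F : cumulative R R) (K : R) : 0 <= K ->
  (forall a b, a <= b -> F b - F a <= K * (b - a)) ->
  lebesgue_stieltjes_measure F `<< leb.
Proof.
move=> K0 FK; apply/null_content_dominatesP => A mA A0.
apply/eqP; rewrite eq_le measure_ge0 andbT.
apply/lee_addgt0Pr => e e0; rewrite add0e.
have K1 : 0 < K + 1 by rewrite ltr_wpDl.
have eK : (0 < (e / (K + 1))%:E)%E by rewrite lte_fin divr_gt0.
have : (leb A < (e / (K + 1))%:E)%E by rewrite [X in (X < _)%E]A0.
rewrite [X in (X < _)%E -> _]/lebesgue_measure /lebesgue_stieltjes_measure.
rewrite /measure_extension /mu_ext => /ereal_inf_lt[_ [B [mB AB] <-]] /ltW Be.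
apply: (@le_trans _ _ (\sum_(k <oo) wlength F (B k))%E).
  by apply: ereal_inf_lbound; exists B.
have BK k : (wlength F (B k) <= (K + 1)%:E * wlength idfun (B k))%E.
  have [[a b] _ /= <-] := mB k; rewrite !wlength_itv /=.
  case: ifPn => [ab|_]; last by rewrite mule0.
  rewrite -!EFinD -EFinM lee_fin.
  have ab' : a <= b by rewrite ltW// -lte_fin.
  by rewrite (le_trans (FK _ _ ab'))// ler_wpM2r ?subr_ge0// lerDl.
apply: (@le_trans _ _ (\sum_(k <oo) (K + 1)%:E * wlength idfun (B k))%E).
  apply: lee_nneseries => *; [exact: wlength_ge0|exact: BK].
rewrite nneseriesZl; last by move=> k _; exact: wlength_ge0.
by rewrite -lee_pdivlMl// muleC -EFinM.
Qed.

(** A Lipschitz function plus a steep linear function is nondecreasing; its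
    Stieltjes measure has a Lebesgue density, which the Lebesgue
    differentiation theorem identifies with the derivative. *)
Lemma lipschitz_FTC (f : R -> R) (L a b : R) :
  (forall x y, `|f x - f y| <= L * `|x - y|) -> a < b ->
  exists g : R -> R, [/\ leb.-integrable `]a, b] (EFin \o g),
    {ae leb, forall x, a < x < b -> is_derive x 1 f (g x)} &
    (\int[leb]_(x in `]a, b]) (g x)%:E = (f b - f a)%:E)%E].
Proof.
move=> fL ab.
have L0 : 0 <= L.
  have := le_trans (normr_ge0 _) (fL b a).
  by rewrite pmulr_lge0// normr_gt0 subr_eq0 gt_eqF.
pose F x := f x + L * x.
have Fnd : {homo F : x y / x <= y}.
  move=> x y xy; have := ler_norm (f x - f y); have := fL x y.
  by rewrite (distrC x) (ger0_norm (x := y - x)) ?subr_ge0// /F; lra.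
have Fc : continuous F.
  move=> x; apply: (@loclip_continuous _ R^o); apply: loclipD.
    by exists L, setT; [exact: filterT|move=> y z _ _; exact: fL].
  apply: loclipM; first exact: (@loclip_cst _ R^o).
  by exists 1, setT; [exact: filterT|move=> y z _ _; rewrite mul1r].
pose Fm := isCumulative.Build R _ R F Fnd (right_continuousW Fc).
pose Fcum : cumulative R R := HB.pack F Fm.
have dom : lebesgue_stieltjes_measure Fcum `<< leb.
  apply: (@le_lebesgue_stieltjes _ (2 * L)); first by rewrite mulr_ge0.
  move=> x y xy; have := ler_norm (f y - f x); have := fL y x.
  by rewrite (ger0_norm (x := y - x)) ?subr_ge0//= /F; lra.
have nuitv x y : x <= y ->
    lebesgue_stieltjes_measure Fcum `]x, y]%classic = (F y - F x)%:E.
  move=> xy; rewrite /lebesgue_stieltjes_measure /measure_extension.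
  by rewrite measurable_mu_extE/= ?wlength_itv_bnd//; exact: is_ocitv.
have mab : measurable (`]a, b]%classic : set (measurableTypeR R)).
  exact: measurable_itv.
have fin : (lebesgue_stieltjes_measure Fcum `]a, b]%classic < +oo)%E.
  by rewrite nuitv ?ltW// ltry.
(* the restriction to the bounded interval is a finite measure, to which the
   Radon-Nikodym theorem applies *)
pose nu : {finite_measure set (measurableTypeR R) -> \bar R} := mfrestr mab fin.
have nudom : nu `<< leb.
  apply/null_content_dominatesP => A mA A0.
  move/null_content_dominatesP : dom; apply; first exact: measurableI.
  apply/eqP; rewrite eq_le measure_ge0 andbT -A0.
  by rewrite le_measure ?inE//; exact: measurableI.
have [h [h0 hfin hint hE]] := radon_nikodym_sigma_finite nudom.
pose k : R -> R := fun x => fine (h x).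
have kE x : (k x)%:E = h x by rewrite fineK.
have kint : leb.-integrable setT (EFin \o k).
  by apply: eq_integrable hint => // x _ /=; rewrite kE.
have kloc : locally_integrable [set: R] k.
  by apply: open_integrable_locally kint; exact: openT.
have kitv y : a <= y -> y <= b ->
    (\int[leb]_(x in `]a, y]) (k x)%:E = (F y - F a)%:E)%E.
  move=> ay yb; under eq_integral do rewrite kE.
  have mY : measurable (`]a, y]%classic : set (measurableTypeR R)) by exact: measurable_itv.
  rewrite -hE//.
  rewrite -nuitv// /nu /= /mfrestr /mrestr; congr (lebesgue_stieltjes_measure _ _).
  apply/setIidPl => x /=; rewrite !in_itv/= => /andP[-> xy].
  exact: le_trans yb.
exists (fun x => k x - L).
have Lint : leb.-integrable `]a, b] (EFin \o cst L).
  apply: (@bounded_integrable _ _ _ _ _ _ L) => //.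
    by rewrite [ltLHS]lebesgue_measure_itv/= lte_fin ab -EFinB ltry.
  by move=> x _; rewrite /= ger0_norm.
have kab : leb.-integrable `]a, b] (EFin \o k).
  by apply: integrableS kint => //; exact: measurable_itv.
split.
- rewrite (_ : _ \o _ = ((EFin \o k) \- (EFin \o cst L))%E)//.
  exact: integrableB.
- have kS y : leb.-integrable [set` Interval (BRight a) (BRight y)] (EFin \o k).
    by apply: integrableS kint => //; exact: measurable_itv.
  have := @FTC1 _ k (BRight a) kS kloc.
  set G := fun x => _.
  apply: filterS; first exact: (ae_filter_ringOfSetsType leb).
  move=> x dG /andP[ax xb].
  have [//|Gd GE] := dG.
  apply: (@near_eq_is_derive _ _ _ (fun y => (G y + F a) - L * y)).
    near=> y; have ya : a < y by near: y; exact: lt_nbhsr.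
    have yb : y < b by near: y; exact: lt_nbhsl.
    by rewrite /G /Rintegral kitv ?ltW//= /F; ring.
  have GD : is_derive x 1 G (k x) by split; [exact: Gd|rewrite -GE derive1E].
  have LD : is_derive x 1 (fun y : R => L * y) L.
    have -> : (fun y : R => L * y) = L \*: id by [].
    by apply: is_derive_eq; rewrite [LHS]mulr1.
  rewrite -[k x]addr0; apply: is_deriveB => //.
- transitivity (\int[leb]_(x in `]a, b]) ((EFin \o k) x - (EFin \o cst L) x))%E.
    by apply: eq_integral => x _; rewrite /= EFinB.
  rewrite (integralB mab kab Lint) (kitv b (ltW ab) (lexx b)).
  have -> : (\int[leb]_(x in `]a, b]) (EFin \o cst L) x = (L * (b - a))%:E)%E.
    transitivity (L%:E * leb `]a, b])%E; first exact: (@integral_cst _ _ _ leb _ mab L%:E).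
    by rewrite lebesgue_measure_itv/= lte_fin ab -EFinB -EFinM.
  rewrite -EFinB /F; apply/eqP; rewrite eqe; apply/eqP; ring.
Unshelve. all: by end_near. Qed.

End lipschitz_real_line.

(** * Borel sets of R^n and slicing of Lebesgue measure *)

Section borel_sets.
Context {R : realType} {n : nat}.
Implicit Types (x y : 'rV[R]_n) (p : 'rV[rat]_n * nat).

Definition rat_center p : 'rV[R]_n := map_mx ratr p.1.

Definition rat_radius p : R := p.2.+1%:R^-1.

Definition rat_ball p := ball (rat_center p) (rat_radius p).

Lemma rat_radius_gt0 p : 0 < rat_radius p.
Proof. by rewrite invr_gt0 ltr0n. Qed.

Lemma ball_rVP x (e : R) y : 0 < e ->
  ball x e y <-> forall i, `|x 0 i - y 0 i| < e.
Proof.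
move=> e0; rewrite -[ball x e y]/(@mx_ball 1 n R R x e y); split.
  by move=> [_ xy] i; have := xy 0 i; rewrite -ball_normE.
by move=> xy; split => // i j; rewrite ord1 -ball_normE; exact: xy.
Qed.

(** The closed ball, and not only the open one, has to stay inside, because a
    Lipschitz function will be extended from it by a retraction. *)
Lemma rat_ball_basis x (e : R) : 0 < e -> exists p, rat_ball p x /\
  forall y, `|rat_center p - y| <= rat_radius p -> ball x e y.
Proof.
move=> e0.
have [k ke] : exists k : nat, k.+1%:R^-1 < e / 2.
  exists (Num.bound (e / 2)^-1).
  rewrite invf_plt ?posrE ?divr_gt0//.
  apply: lt_trans (archi_boundP _) _; first by rewrite invr_ge0 divr_ge0// ltW.
  by rewrite ltr_nat.
have k0 : 0 < k.+1%:R^-1 :> R by rewrite invr_gt0 ltr0n.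
have Q i : exists q : rat, ratr q \in `]x 0 i - k.+1%:R^-1, x 0 i + k.+1%:R^-1[.
  by apply: rat_in_itvoo; rewrite ltrBlDr -addrA ltrDl addr_gt0.
have [q qx] := choice Q.
have xq : rat_ball (\row_i q i, k) x.
  apply/ball_rVP => [|i]; first exact: rat_radius_gt0.
  by rewrite !mxE ltr_distl; have := qx i; rewrite in_itv.
exists (\row_i q i, k); split => // y yq.
move: xq; rewrite /rat_ball -!ball_normE /= => xq.
apply: le_lt_trans (ler_distD (rat_center (\row_i q i, k)) _ _) _.
rewrite distrC [ltRHS]splitr ltrD//; first exact: lt_trans xq ke.
exact: le_lt_trans yq ke.
Qed.

Lemma measurable_rV_ball x (r : R) : measurable (ball x r).
Proof.
have [r0|r0] := ltP 0 r; last first.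
  rewrite (_ : ball x r = set0); first exact: measurable0.
  apply/seteqP; split => // y; rewrite -ball_normE /= => xy.
  by have := le_lt_trans (normr_ge0 _) (lt_le_trans xy r0); rewrite ltxx.
rewrite [X in measurable X](_ : _ = \bigcap_(j in [set: 'I_n])
    (rV_coord j @^-1` ball (x 0 j) r)).
  apply: fin_bigcap_measurable => // j _; rewrite -[X in measurable X]setTI.
  by apply: measurable_rV_coord => //; exact: measurable_ball.
apply/seteqP; split => [y /(ball_rVP _ _ r0) yx j _|y yx].
  by rewrite /= -ball_normE; exact: yx.
by apply/(ball_rVP _ _ r0) => j; have := yx j I; rewrite /= -ball_normE.
Qed.

Lemma open_rat_ball (O : set 'rV[R]_n) : open O ->
  O = \bigcup_(p in [set p | rat_ball p `<=` O]) rat_ball p.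
Proof.
rewrite openE => oO; apply/seteqP; split => [x Ox|x [p pO px]]; last exact: pO.
have /nbhs_ballP[e /= e0 eO] := oO x Ox.
have [p [px pe]] := rat_ball_basis x e0; exists p => // y py.
by apply/eO/pe/ltW; move: py; rewrite /rat_ball -ball_normE.
Qed.

Lemma measurable_bigcup_count (I : countType) (D : set I)
    (F : I -> set 'rV[R]_n) :
  (forall i, D i -> measurable (F i)) -> measurable (\bigcup_(i in D) F i).
Proof.
move=> mF; rewrite bigcup_mkcond; apply: countable_bigcupT_measurable.
  exact: countableP.
by move=> i; case: ifPn => [/set_mem/mF//|_]; exact: measurable0.
Qed.

Lemma open_measurable_rV (O : set 'rV[R]_n) : open O -> measurable O.
Proof.
move=> /open_rat_ball ->; apply: measurable_bigcup_count => p _.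
exact: measurable_rV_ball.
Qed.

Lemma continuous_measurable_rV (O : set 'rV[R]_n) (f : 'rV[R]_n -> R) :
  open O -> (forall x, O x -> {for x, continuous f}) -> measurable_fun O f.
Proof.
move=> oO fO mO; apply: (measurability _ (RGenOpens.measurableE R)) => //.
move=> _ [_ [a [b ->] <-]]; apply: open_measurable_rV.
rewrite openE => x [Ox fx]; apply: filterI; first exact: open_nbhs_nbhs.
by apply: fO => //; apply: open_nbhs_nbhs; split => //; exact: interval_open.
Qed.

Lemma lebesgue_rV_bounded (A : set 'rV[R]_n) (r : R) : measurable A ->
  (forall x, A x -> `|x| <= r) -> (lebesgue_rV n A < +oo)%E.
Proof.
move=> mA Ar; pose s := Num.max r 0.
pose B : set 'rV[R]_n := [set x | forall i,
  x 0 i \in `[(const_mx (- s) : 'rV[R]_n) 0 i, (const_mx s : 'rV[R]_n) 0 i]].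
have s0 : 0 <= s by rewrite le_max lexx orbT.
have mB : measurable B.
  rewrite [X in measurable X](_ : _ = \bigcap_(j in [set: 'I_n])
      (rV_coord j @^-1` `[- s, s]%classic)).
    apply: fin_bigcap_measurable => // j _; rewrite -[X in measurable X]setTI.
    by apply: measurable_rV_coord => //; exact: measurable_itv.
  apply/seteqP; split => x /= Bx j.
    by move=> _; have := Bx j; rewrite !mxE.
  by have := Bx j I; rewrite !mxE.
apply: (@le_lt_trans _ _ (lebesgue_rV n B)).
  apply: le_measure; rewrite ?inE// => x /Ar xr i.
  rewrite !mxE in_itv /= -ler_norml (le_trans (normr_coord _ _))//.
  by rewrite (le_trans xr)// le_max lexx.
rewrite lebesgue_rV_box ?ltry// => i; rewrite !mxE; lra.
Qed.

End borel_sets.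

Section slices.
Context {R : realType} {n : nat}.

(** The measure is built by adding the first coordinate to the last n ones, so
    the two directions of slicing are a line (head) and a hyperplane (tail). *)
Lemma lebesgue_rV_null_head (A : set 'rV[R]_n.+1) : measurable A ->
  (forall y, lebesgue_measure
     ((fun t => rV_cons (t, y)) @^-1` A : set (measurableTypeR R)) = 0%E) ->
  lebesgue_rV n.+1 A = 0%E.
Proof.
move=> mA A0.
have mcA : measurable (@rV_cons R n @^-1` A).
  by rewrite -[X in measurable X]setTI; exact: measurable_rV_cons.
transitivity ((@lebesgue_measure R \x lebesgue_rV n)%E (@rV_cons R n @^-1` A)) => //.
transitivity ((@lebesgue_measure R \x^ lebesgue_rV n)%E (@rV_cons R n @^-1` A)).
  by apply: product_measure_unique => // B C mB mC/=; rewrite product_measure2E.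
apply: integral0_eq => y _ /=; rewrite -[RHS](A0 y); congr (lebesgue_measure _).
by apply/seteqP; split => t; rewrite /ysection /= inE.
Qed.

Lemma lebesgue_rV_null_tail (A : set 'rV[R]_n.+1) : measurable A ->
  (forall t, lebesgue_rV n ((fun y => rV_cons (t, y)) @^-1` A) = 0%E) ->
  lebesgue_rV n.+1 A = 0%E.
Proof.
move=> mA A0; apply: integral0_eq => t _ /=; rewrite -[RHS](A0 t).
congr (lebesgue_rV n _).
by apply/seteqP; split => y; rewrite /xsection /= inE.
Qed.

Variable F : 'rV[R]_n.+1 -> \bar R.
Hypothesis intF : (lebesgue_rV n.+1).-integrable setT F.

Let intFc : (@lebesgue_measure R \x lebesgue_rV n)%E.-integrable setT
  (F \o @rV_cons R n).
Proof.
have [mF Foo] := integrableP _ _ _ intF.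
apply/integrableP; split.
  exact: (measurableT_comp mF (@measurable_rV_cons R n)).
apply: le_lt_trans Foo.
have mF' : measurable_fun setT (fun x => `|F x|%E) by exact: measurableT_comp.
by rewrite -(ge0_integral_pushforward (@measurable_rV_cons R n)
  (@lebesgue_measure R \x lebesgue_rV n)%E measurableT mF').
Qed.

Let integral_rV_cons : (\int[lebesgue_rV n.+1]_x F x =
  \int[(@lebesgue_measure R \x lebesgue_rV n)%E]_p F (rV_cons p))%E.
Proof.
have [mF _] := integrableP _ _ _ intF.
exact: (integral_pushforward (@measurable_rV_cons R n) mF intFc measurableT).
Qed.

Lemma integral_rV_tail : (\int[lebesgue_rV n.+1]_x F x =
  \int[@lebesgue_measure R]_t \int[lebesgue_rV n]_y F (rV_cons (t, y)))%E.
Proof.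
by rewrite integral_rV_cons -integral12_prod_meas1.
Qed.

Lemma integral_rV_head : (\int[lebesgue_rV n.+1]_x F x =
  \int[lebesgue_rV n]_y \int[@lebesgue_measure R]_t F (rV_cons (t, y)))%E.
Proof.
by rewrite integral_rV_cons -integral21_prod_meas1.
Qed.

End slices.

(** * Measurability of directional derivatives *)

Section derivability_set.
Context {R : realType} {n : nat}.
Implicit Types (f : 'rV[R]_n -> R) (x y v : 'rV[R]_n).

Let quot f v (h : R) x : R := h^-1 * (f (h *: v + x) - f x).

Let continuous_quot f v h : continuous f -> continuous (quot f v h).
Proof.
move=> cf x.
have c1 : {for x, continuous (fun y => f (h *: v + y))}.
  apply: (@continuous_comp _ _ _ (fun y => h *: v + y) f); last exact: cf.
  by apply: (@continuousD _ _ _ (cst (h *: v)) id x);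
    [exact: cst_continuous|exact: cvg_id].
have c2 : {for x, continuous (fun y => f (h *: v + y) - f y)}.
  exact: (continuousB c1 (cf x)).
by apply: (continuousM _ c2); exact: cst_continuous.
Qed.

Let derivable_quot f v x :
  derivable f x v = cvg (quot f v h x @[h --> 0^']).
Proof. by []. Qed.

Let small (m : nat) : set R := [set h | h != 0 /\ `|h| < m.+1%:R^-1].

Let small_dnbhs m : (0^' : set_system R) (small m).
Proof.
apply/nbhs_ballP; exists m.+1%:R^-1 => /=; first by rewrite invr_gt0 ltr0n.
by move=> h; rewrite -ball_normE /= sub0r normrN => hm h0; split.
Qed.

(** The Cauchy criterion with radii 1/(m+1) and tolerances 1/(k+1) turns
    derivability into countable operations. *)
Let derivable_cauchy f v x : derivable f x v <-> forall k, exists m,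
  forall h h', small m h -> small m h' ->
    `|quot f v h x - quot f v h' x| <= k.+1%:R^-1.
Proof.
rewrite derivable_quot; split.
  move=> /cvg_ex[l /cvgrPdist_lt fl] k.
  have k0 : 0 < k.+1%:R^-1 / 2 :> R by rewrite divr_gt0// invr_gt0 ltr0n.
  have /nbhs_ballP[e /= e0 eP] := fl _ k0.
  have [m me] : exists m : nat, m.+1%:R^-1 < e.
    exists (Num.bound e^-1); rewrite invf_plt ?posrE//.
    apply: lt_trans (archi_boundP _) _; first by rewrite invr_ge0 ltW.
    by rewrite ltr_nat.
  have lh h : small m h -> `|l - quot f v h x| < k.+1%:R^-1 / 2.
    move=> [h0 hm]; apply: eP => //.
    by rewrite -ball_normE /= sub0r normrN (lt_trans hm).
  exists m => h h' hm hm'; apply: le_trans (ler_distD l _ _) _.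
  rewrite [leRHS]splitr; apply: lerD; last exact: ltW (lh _ hm').
  by rewrite distrC; exact: ltW (lh _ hm).
move=> fk; apply/cauchy_cvgP/cauchy_ballP => e e0.
have [k ke] : exists k : nat, k.+1%:R^-1 < e.
  exists (Num.bound e^-1); rewrite invf_plt ?posrE//.
  apply: lt_trans (archi_boundP _) _; first by rewrite invr_ge0 ltW.
  by rewrite ltr_nat.
have [m mP] := fk k.
pose A := [set q | exists2 h, small m h & q = quot f v h x].
have FA : (quot f v h x @[h --> 0^']) A.
  by apply: filterS (small_dnbhs m) => h hm; exists h.
exists (A, A) => // -[_ _] [/= [h hm ->] [h' hm' ->]].
by rewrite -ball_normE /=; apply: le_lt_trans (mP _ _ hm hm') ke.
Qed.

(** The oscillation of the difference quotients near 0 is measurable because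
    suprema of continuous functions are lower semicontinuous. *)
Lemma measurable_derivable f v : continuous f ->
  measurable [set x | derivable f x v].
Proof.
move=> cf.
have cq h : continuous (quot f v h) by exact: continuous_quot.
pose O k (hh : R * R) : set 'rV[R]_n :=
  [set x | k.+1%:R^-1 < `|quot f v hh.1 x - quot f v hh.2 x|].
pose B k m := \bigcup_(hh in [set hh | small m hh.1 /\ small m hh.2]) O k hh.
have oB k m : open (B k m).
  apply: bigcup_open => -[h h'] _.
  rewrite (_ : O _ _ = (fun x => `|quot f v h x - quot f v h' x|) @^-1`
    [set s : R | k.+1%:R^-1 < s])//.
  apply: open_comp; last exact: open_gt.
  move=> x _; apply: (@continuous_comp _ _ _
    (fun y => quot f v h y - quot f v h' y) (fun s : R => `|s|)).
    exact: (continuousB (cq h x) (cq h' x)).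
  exact: norm_continuous.
rewrite [X in measurable X](_ : _ = ~` \bigcup_k \bigcap_m B k m).
  apply: measurableC; apply: bigcupT_measurable => k.
  by apply: bigcapT_measurable => m; exact: open_measurable_rV.
apply/seteqP; split => x.
  move=> /derivable_cauchy fk [k _ kB]; have [m mP] := fk k.
  have [[h h'] /= [hm hm'] hh'] := kB m I.
  by have := lt_le_trans hh' (mP _ _ hm hm'); rewrite ltxx.
move=> xB; apply/derivable_cauchy => k.
apply: contrapT => /forallNP kN; apply: xB; exists k => // m _.
apply: contrapT => Bm; apply: (kN m) => h h' hm hm'.
by rewrite leNgt; apply/negP => hh'; apply: Bm; exists (h, h').
Qed.

Lemma measurable_derive f v : continuous f ->
  measurable_fun setT ('D_v f : 'rV[R]_n -> R).
Proof.
move=> cf; pose D := [set x | derivable f x v].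
have mD : measurable D by exact: measurable_derivable.
rewrite -(setUv D); apply/measurable_funU => //; first exact: measurableC.
split; last first.
  (* a limit that does not exist is the default point 0 *)
  apply: (@eq_measurable_fun _ _ _ _ _ (cst (0 : R))).
    by move=> x /set_mem ND; rewrite /derive dvgP.
  exact: measurable_cst.
apply: (@measurable_fun_cvg _ _ _ _ (fun m x => quot f v m.+1%:R^-1 x)).
  move=> m; apply: measurable_funTS; apply: continuous_measurable_rV => //.
    exact: openT.
  by move=> x _; exact: continuous_quot.
move=> x Dx; have /cvgrPdist_lt fx : quot f v h x @[h --> 0^'] --> 'D_v f x by [].
apply/cvgrPdist_lt => e e0; have /nbhs_ballP[r /= r0 rP] := fx e e0.
near=> m; apply: rP; last by rewrite invr_eq0.
rewrite -ball_normE /= sub0r normrN ger0_norm ?invr_ge0//.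
by near: m; exact: near_infty_natSinv_lt (PosNum r0).
Unshelve. all: by end_near. Qed.

(** Valid at every point, since the derivative is 0 where the difference
    quotients diverge. *)
Lemma lipschitz_derive_le f v (L : R) x : 0 <= L ->
  (forall x y, `|f x - f y| <= L * `|x - y|) -> `|'D_v f x| <= L * `|v|.
Proof.
move=> L0 fL; have [Dx|Dx] := pselect (derivable f x v); last first.
  by rewrite /derive dvgP// normr0 mulr_ge0.
have fx : `|quot f v h x| @[h --> 0^'] --> `|'D_v f x|.
  by apply: cvg_norm; exact: Dx.
rewrite -(cvg_lim (@Rhausdorff R) fx).
apply: limr_le; first by apply/cvg_ex; exists `|'D_v f x|.
near=> h; have hn : h != 0 by near: h; exact: nbhs_dnbhs_neq.
rewrite /quot normrM normfV ler_pdivrMl ?normr_gt0// mulrCA -normrZ.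
by apply: le_trans (fL _ _) _; rewrite addrK.
Unshelve. all: by end_near. Qed.

End derivability_set.

(** * Partial derivatives of Lipschitz functions on R^n *)

Section slicing.
Context {R : realType} {n : nat}.
Implicit Types (f : 'rV[R]_n.+1 -> R) (t : R) (y : 'rV[R]_n).

Lemma rV_cons_head t y (h : R) :
  rV_cons (h + t, y) = h *: delta_mx 0 ord0 + rV_cons (t, y).
Proof.
apply/rowP => i; case: (unliftP ord0 i) => [j ->|->].
  by rewrite !mxE liftK/= mulr0 add0r.
by rewrite !mxE unlift_none/= mulr1.
Qed.

Lemma rV_cons_tail t y (h : R) (j : 'I_n) :
  rV_cons (t, h *: delta_mx 0 j + y) =
  h *: delta_mx 0 (lift ord0 j) + rV_cons (t, y).
Proof.
apply/rowP => i; case: (unliftP ord0 i) => [k ->|->].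
  by rewrite !mxE liftK/= !mxE (inj_eq (@lift_inj _ _)).
by rewrite !mxE unlift_none/= mulr0 add0r.
Qed.

Lemma head_quotient f t y :
  (fun h : R => h^-1 *: (((fun s => f (rV_cons (s, y))) \o shift t) (h *: (1 : R))
     - f (rV_cons (t, y)))) =
  (fun h => h^-1 *: ((f \o shift (rV_cons (t, y))) (h *: delta_mx 0 ord0) -
     f (rV_cons (t, y)))).
Proof.
apply/funext => h /=; congr (_ *: (f _ - _)).
by rewrite [h *: 1]mulr1 rV_cons_head.
Qed.

Lemma tail_quotient f t y (j : 'I_n) :
  (fun h : R => h^-1 *: (((fun z => f (rV_cons (t, z))) \o shift y)
     (h *: delta_mx 0 j) - f (rV_cons (t, y)))) =
  (fun h => h^-1 *: ((f \o shift (rV_cons (t, y)))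
     (h *: delta_mx 0 (lift ord0 j)) - f (rV_cons (t, y)))).
Proof.
by apply/funext => h /=; congr (_ *: (f _ - _)); rewrite rV_cons_tail.
Qed.

Lemma derivable_head f t y : derivable (fun s => f (rV_cons (s, y))) t 1 =
  derivable f (rV_cons (t, y)) (delta_mx 0 ord0).
Proof. by rewrite /derivable head_quotient. Qed.

Lemma derive_head f t y : 'D_1 (fun s => f (rV_cons (s, y))) t =
  partial ord0 f (rV_cons (t, y)).
Proof. by rewrite /partial /derive head_quotient. Qed.

Lemma derivable_tail f t y (j : 'I_n) :
  derivable (fun z => f (rV_cons (t, z))) y (delta_mx 0 j) =
  derivable f (rV_cons (t, y)) (delta_mx 0 (lift ord0 j)).
Proof. by rewrite /derivable tail_quotient. Qed.

Lemma derive_tail f t y (j : 'I_n) :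
  partial j (fun z => f (rV_cons (t, z))) y =
  partial (lift ord0 j) f (rV_cons (t, y)).
Proof. by rewrite /partial /derive tail_quotient. Qed.

Lemma normr_rV_le m (v : 'rV[R]_m) (c : R) : 0 <= c ->
  (forall i, `|v 0 i| <= c) -> `|v| <= c.
Proof.
move=> c0 vc; rewrite [leLHS]/Num.norm /= mx_normrE.
by apply: bigmax_le => // -[i j] _; rewrite ord1; exact: vc.
Qed.

Lemma rV_cons_dist_head (s t : R) y :
  `|rV_cons (s, y) - rV_cons (t, y)| <= `|s - t|.
Proof.
apply: normr_rV_le => // i; rewrite !mxE; case: (unlift ord0 i) => [j|] //=.
by rewrite subrr normr0.
Qed.

Lemma rV_cons_dist_tail t y (z : 'rV[R]_n) :
  `|rV_cons (t, y) - rV_cons (t, z)| <= `|y - z|.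
Proof.
apply: normr_rV_le => // i; rewrite !mxE; case: (unlift ord0 i) => [j|] /=.
  by have := normr_coord (y - z) j; rewrite !mxE.
by rewrite subrr normr0.
Qed.

Lemma normr_rV_cons_head t y : `|t| <= `|rV_cons (t, y)|.
Proof. by have := normr_coord (rV_cons (t, y)) ord0; rewrite rV_cons0. Qed.

Lemma normr_rV_cons_tail t y : `|y| <= `|rV_cons (t, y)|.
Proof.
apply: normr_rV_le => // i.
by have := normr_coord (rV_cons (t, y)) (lift ord0 i); rewrite rV_consS.
Qed.

Lemma measurable_rV_cons_head y :
  measurable_fun setT (fun t : measurableTypeR R => rV_cons (t, y)).
Proof.
apply: (measurableT_comp (@measurable_rV_cons R n)).
exact: measurable_pair2.
Qed.

End slicing.

Section lipschitz_partial.
Context {R : realType}.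
Notation leb := (@lebesgue_measure R).

Definition lipschitz_with n (L : R) (f : 'rV[R]_n -> R) :=
  forall x y, `|f x - f y| <= L * `|x - y|.

Lemma lipschitz_with_continuous n L (f : 'rV[R]_n -> R) :
  lipschitz_with L f -> continuous f.
Proof.
move=> fL x; apply: loclip_continuous; exists L, setT; first exact: filterT.
by move=> y z _ _; exact: fL.
Qed.

Section lipschitz_slices.
Context {n : nat} {L : R} {f : 'rV[R]_n.+1 -> R} (L0 : 0 <= L).
Hypothesis fL : lipschitz_with L f.

Lemma lipschitz_head y (s t : R) :
  `|f (rV_cons (s, y)) - f (rV_cons (t, y))| <= L * `|s - t|.
Proof.
by apply: le_trans (fL _ _) _; rewrite ler_wpM2l// rV_cons_dist_head.
Qed.

Lemma lipschitz_tail (t : R) : lipschitz_with L (fun y => f (rV_cons (t, y))).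
Proof.
move=> y z; apply: le_trans (fL _ _) _.
by rewrite ler_wpM2l// rV_cons_dist_tail.
Qed.

End lipschitz_slices.

Lemma lipschitz_derivable_ae1 (phi : R -> R) (L : R) :
  (forall s t, `|phi s - phi t| <= L * `|s - t|) ->
  leb.-negligible [set t | ~ derivable phi t 1].
Proof.
move=> phiL.
pose N (k : nat) : set (measurableTypeR R) :=
  [set t : R | - k.+1%:R < t < k.+1%:R /\ ~ derivable phi t 1].
suff NN : leb.-negligible (\bigcup_k N k).
  apply: negligibleS NN.
  move=> t /= tN; exists (Num.bound `|t|) => //=; split => //.
  rewrite -ltr_norml; apply: lt_le_trans (archi_boundP (normr_ge0 t)) _.
  by rewrite ler_nat.
apply: negligible_bigcup => k.
have [|g [_ [M [mM M0 gM]] _]] := @lipschitz_FTC R phi L (- k.+1%:R) k.+1%:R phiL.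
  by rewrite gtrN.
exists M; split => // t [tk tN]; apply: gM => /= /(_ tk)[].
by move=> + _; exact: tN.
Qed.

(** Rademacher's theorem for partial derivatives. The first partial derivative
    is taken along lines, where the one-dimensional theorem applies; the other
    ones are taken inside hyperplanes, where the induction hypothesis does. *)
Lemma lipschitz_derivable_null n (f : 'rV[R]_n -> R) (L : R) (i : 'I_n) :
  0 <= L -> lipschitz_with L f ->
  lebesgue_rV n [set x | ~ derivable f x (delta_mx 0 i)] = 0%E.
Proof.
move=> L0; elim: n f i => [f [] //|n IH] f i fL.
have mN : measurable [set x | ~ derivable f x (delta_mx 0 i)].
  apply: measurableC; apply: measurable_derivable.
  exact: lipschitz_with_continuous fL.
case: (unliftP ord0 i) mN => [j|] ->{i} mN.
  apply: lebesgue_rV_null_tail => // t.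
  have E := IH (fun y => f (rV_cons (t, y))) j (lipschitz_tail L0 fL t).
  rewrite [X in lebesgue_rV n X](_ : _ =
    [set y | ~ derivable (fun z => f (rV_cons (t, z))) y (delta_mx 0 j)]).
    exact: E.
  by apply/seteqP; split => y /=; rewrite derivable_tail.
apply: lebesgue_rV_null_head => // y; apply/negligibleP.
  rewrite -[X in measurable X]setTI.
  by apply: measurable_rV_cons_head.
apply: negligibleS (lipschitz_derivable_ae1 (lipschitz_head L0 fL y)).
by move=> t /=; rewrite derivable_head.
Qed.

Section bounded_support.
Context {n : nat} (f : 'rV[R]_n -> R) (L r : R) (i : 'I_n).
Hypotheses (L0 : 0 <= L) (fL : lipschitz_with L f).
Hypothesis f0 : forall x, r <= `|x| -> f x = 0.

Lemma measurable_partial_lipschitz : measurable_fun setT (partial i f).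
Proof. by apply: measurable_derive; exact: lipschitz_with_continuous fL. Qed.

Lemma partial_lipschitz_le x : `|partial i f x| <= L.
Proof.
apply: le_trans (lipschitz_derive_le _ _ L0 fL) _.
rewrite -[leRHS]mulr1 ler_wpM2l//; apply: normr_rV_le => // j.
by rewrite mxE eqxx /=; case: eqP; rewrite ?normr1 ?normr0.
Qed.

Lemma partial_support x : r < `|x| -> partial i f x = 0.
Proof.
move=> xr; rewrite -(derive_cst (0 : R) x (delta_mx 0 i)).
apply: near_eq_derive; near=> y; apply: f0; apply: ltW; near: y.
exact: (cvgr_gt _ (@norm_continuous _ _ x)).
Unshelve. all: by end_near. Qed.

Lemma integrable_partial_lipschitz :
  (lebesgue_rV n).-integrable setT (EFin \o partial i f).
Proof.
pose A : set 'rV[R]_n := [set x | `|x| <= r].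
have mA : measurable A.
  rewrite (_ : A = ~` [set x | r < `|x|]).
    apply: measurableC; apply: open_measurable_rV.
    rewrite (_ : mkset _ = (fun x : 'rV[R]_n => `|x|) @^-1` [set s : R | r < s])//.
    by apply: open_comp => [x _|]; [exact: norm_continuous|exact: open_gt].
  rewrite /A; apply/seteqP; split => x /=; first by rewrite leNgt => /negP.
  by move=> /negP; rewrite -leNgt.
have mP := measurable_partial_lipschitz.
have : (lebesgue_rV n).-integrable A (EFin \o partial i f).
  apply: (@bounded_integrable _ _ _ _ _ _ L) => //.
  - exact: lebesgue_rV_bounded mA (fun x Ax => Ax).
  - exact: measurable_funTS.
  - by move=> x _; exact: partial_lipschitz_le.
rewrite integrable_mkcond//; apply: eq_integrable => // x _.
rewrite patchE; case: ifPn => //; rewrite notin_setE /= => /negP.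
by rewrite -ltNge => xr; rewrite partial_support.
Qed.

End bounded_support.

(** The integral of the derivative over an interval that contains the support
    is the difference of two vanishing values. *)
Lemma integral_derive_lipschitz (phi : R -> R) (L r : R) : 0 <= L ->
  (forall s t, `|phi s - phi t| <= L * `|s - t|) ->
  (forall t, r <= `|t| -> phi t = 0) ->
  measurable_fun setT ('D_1 phi : R -> R) ->
  (\int[leb]_t ('D_1 phi t)%:E = 0)%E.
Proof.
move=> L0 phiL phi0 mphi; pose s := Num.max r 0 + 1.
have s0 : 0 < s by rewrite ltr_wpDl// le_max lexx orbT.
have rs : r < s by rewrite ltr_pwDr// le_max lexx.
have [|g [gint gphi gE]] := @lipschitz_FTC R phi L (- s) s phiL.
  by rewrite gtrN.
have phis t : s <= `|t| -> phi t = 0.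
  by move=> st; apply: phi0; apply: le_trans (ltW rs) st.
have gE0 : (\int[leb]_(t in `](- s)%R, s]) (g t)%:E = 0)%E.
  have ss : s <= `|s| by exact: ler_norm.
  by rewrite gE (phis s ss) (phis (- s)) ?normrN// subrr.
have mI : measurable (`]- s, s]%classic : set (measurableTypeR R)).
  exact: measurable_itv.
rewrite -[RHS]gE0.
transitivity (\int[leb]_(t in `](- s)%R, s]) ('D_1 phi t)%:E)%E.
  rewrite [RHS]integral_mkcond; apply: eq_integral => t _.
  rewrite patchE; case: ifPn => //; rewrite notin_setE /= in_itv /=.
  move=> /negP; rewrite negb_and -leNgt -ltNge => ts; congr EFin.
  rewrite -(derive_cst (0 : R) t 1); apply: near_eq_derive; near=> u.
  apply: phi0; apply: ltW; near: u; apply: (cvgr_gt _ (@norm_continuous _ _ t)).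
  apply: lt_le_trans rs _; case/orP: ts => ts; last first.
    by apply: le_trans (ltW ts) (ler_norm _).
  by rewrite -normrN; apply: le_trans (ler_norm _); rewrite lerNr.
apply: ae_eq_integral => //.
- by apply/measurable_EFinP; exact: measurable_funTS.
- by have /integrableP[] := gint.
(* the derivative is identified in the open interval only, so the right end
   point of the half-open one is discarded *)
have ns : {ae leb, forall t, t <> s}.
  exists [set s]; split; [exact: measurable_set1|exact: lebesgue_measure_set1|].
  by move=> t /= /contrapT.
apply: filterS2 ns gphi => [|t ts gt].
  exact: (ae_filter_ringOfSetsType leb).
rewrite /= in_itv /= => /andP[st ts']; congr EFin.
have [|_ ->//] := gt; rewrite st lt_neqAle ts' andbT.
exact/eqP.
Unshelve. all: by end_near. Qed.

Lemma integral_partial_lipschitz n (f : 'rV[R]_n -> R) (L r : R) (i : 'I_n) :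
  0 <= L -> lipschitz_with L f -> (forall x, r <= `|x| -> f x = 0) ->
  (\int[lebesgue_rV n]_x (partial i f x)%:E = 0)%E.
Proof.
move=> L0; elim: n f i => [f [] //|n IH] f i fL f0.
have intP := integrable_partial_lipschitz i L0 fL f0.
case: (unliftP ord0 i) intP => [j|] ->{i} intP.
  rewrite integral_rV_tail//; apply: integral0_eq => t _.
  have f0t y : r <= `|y| -> f (rV_cons (t, y)) = 0.
    by move=> yr; apply: f0; apply: le_trans yr (normr_rV_cons_tail _ _).
  have E := IH (fun y => f (rV_cons (t, y))) j (lipschitz_tail L0 fL t) f0t.
  by rewrite -[RHS]E; apply: eq_integral => y _; rewrite derive_tail.
rewrite integral_rV_head//; apply: integral0_eq => y _.
transitivity (\int[leb]_t ('D_(1 : R) (fun u : R => f (rV_cons (u, y))) t)%:E)%E.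
  by apply: eq_integral => t _; rewrite derive_head.
apply: (integral_derive_lipschitz L0 (r := r)).
- exact: lipschitz_head.
- by move=> t tr; apply: f0; apply: le_trans tr (normr_rV_cons_head _ _).
- rewrite (_ : 'D_(1 : R) _ = partial ord0 f \o (fun t => rV_cons (t, y))).
    apply: measurableT_comp; last exact: measurable_rV_cons_head.
    exact: measurable_partial_lipschitz fL.
  by apply/funext => t /=; rewrite -derive_head.
Qed.

End lipschitz_partial.

(** * Localization to open sets *)

Lemma negligible_bigcup_count d (T : measurableType d) (R : realType)
    (mu : {measure set T -> \bar R}) (I : countType) (F : I -> set T) :
  (forall i, mu.-negligible (F i)) -> mu.-negligible (\bigcup_i F i).
Proof.
move=> F0; pose G k := oapp F set0 (unpickle k).
apply: (@negligibleS _ _ _ _ (\bigcup_k G k)).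
  by move=> x [i _ Fix]; exists (pickle i) => //; rewrite /G pickleK.
apply: negligible_bigcup => k; rewrite /G; case: unpickle => [i|] /=.
  exact: F0.
exact: negligible_set0.
Qed.

Section clamp.
Context {R : realType} {n : nat}.
Implicit Types (x y z c : 'rV[R]_n).

(** The coordinatewise retraction onto the closed ball of centre c and radius r
    of the sup norm; it is 1-Lipschitz, so that composition with it extends
    Lipschitz functions from that ball to the whole space. *)
Definition clamp c (r : R) y : 'rV[R]_n :=
  \row_i Num.max (c 0 i - r) (Num.min (c 0 i + r) (y 0 i)).

Lemma clamp_dist c r y z : `|clamp c r y - clamp c r z| <= `|y - z|.
Proof.
apply: normr_rV_le => // i; rewrite !mxE.
apply: (@le_trans _ _ `|y 0 i - z 0 i|); last first.
  by have := normr_coord (y - z) i; rewrite !mxE.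
set a := _ - r; set b := _ + r; move: (y 0 i) (z 0 i) => s t.
rewrite ler_norml; have := ler_norm (s - t); have := ler_norm (t - s).
rewrite (distrC t) => ts st.
by case: (leP b s) => ?; case: (leP b t) => ?; do ![case: (leP a) => ?]; lra.
Qed.

Lemma clamp_in c r y : 0 <= r -> `|c - clamp c r y| <= r.
Proof.
move=> r0; apply: normr_rV_le => // i; rewrite !mxE ler_norml.
by case: (leP (c 0 i + r)) => ?; case: (leP (c 0 i - r)) => ?; lra.
Qed.

Lemma clamp_id c r y : `|c - y| <= r -> clamp c r y = y.
Proof.
move=> cy; apply/rowP => i; rewrite !mxE.
have := le_trans (normr_coord (c - y) i) cy; rewrite !mxE ler_norml => /andP[? ?].
by case: (leP (c 0 i + r)) => ?; case: (leP (c 0 i - r)) => ?; lra.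
Qed.

End clamp.

Section local_lipschitz_partial.
Context {R : realType} {n : nat}.
Variables (Omega : set 'rV[R]_n) (f : 'rV[R]_n -> R).
Hypotheses (oO : open Omega) (fO : forall x, Omega x -> loclip_at f x).

(** A rational ball on which f agrees with a Lipschitz function of the whole
    space. There are countably many such balls, and they cover Omega. *)
Let chart (p : 'rV[rat]_n * nat) (g : 'rV[R]_n -> R) :=
  [/\ rat_ball p `<=` Omega, (exists2 L, 0 <= L & lipschitz_with L g) &
      forall y, rat_ball p y -> f y = g y].

Let chart_cover x : Omega x -> exists p g, chart p g /\ rat_ball p x.
Proof.
move=> Ox; have [L L0 [U xU fL]] := loclip_pos (fO Ox).
have : nbhs x (U `&` Omega) by apply: filterI => //; exact: open_nbhs_nbhs.
move=> /nbhs_ballP[e /= e0 eU]; have [p [px pe]] := rat_ball_basis x e0.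
exists p, (fun y => f (clamp (rat_center p) (rat_radius p) y)).
have r0 := ltW (@rat_radius_gt0 R n p).
split => //; split.
- by move=> y; rewrite /rat_ball -ball_normE /= => /ltW /pe /eU[].
- exists L; first exact: ltW.
  move=> y z; apply: le_trans (fL _ _ _ _) _.
  + by have [] := eU _ (pe _ (clamp_in _ y r0)).
  + by have [] := eU _ (pe _ (clamp_in _ z r0)).
  + by rewrite ler_pM2l// clamp_dist.
- by move=> y; rewrite /rat_ball -ball_normE /= => /ltW /clamp_id ->.
Qed.

Let chart_near p g x : chart p g -> rat_ball p x -> \forall y \near x, g y = f y.
Proof.
move=> [_ _ fg] px; apply: (@filterS _ _ _ (rat_ball p)).
  by move=> y /fg.
by apply: open_nbhs_nbhs; split => //; exact: ball_open.
Qed.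

Lemma loclip_derivable_ae (i : 'I_n) :
  {ae lebesgue_rV n, forall x, Omega x -> derivable f x (delta_mx 0 i)}.
Proof.
pose F p := [set x | [/\ exists g, chart p g, rat_ball p x &
  ~ derivable f x (delta_mx 0 i)]].
apply: (@negligibleS _ _ _ _ (\bigcup_p F p)).
  move=> x /= /not_implyP[Ox fx]; have [p [g [pg px]]] := chart_cover Ox.
  by exists p => //; split => //; exists g.
apply: negligible_bigcup_count => p.
have [[g pg]|Np] := pselect (exists g, chart p g); last first.
  apply: negligibleS (negligible_set0 _) => x [].
  by move=> /Np.
have [_ [L L0 gL] _] := pg.
apply: (@negligibleS _ _ _ _ [set x | ~ derivable g x (delta_mx 0 i)]).
  move=> x [_ px fx] gx; apply: fx.
  exact: near_eq_derivable (chart_near pg px) gx.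
apply/negligibleP; last exact: lipschitz_derivable_null gL.
apply: measurableC; apply: measurable_derivable.
exact: lipschitz_with_continuous gL.
Qed.

Lemma loclip_measurable_partial (i : 'I_n) : measurable_fun Omega (partial i f).
Proof.
move=> _ Y mY.
rewrite [X in measurable X](_ : _ = \bigcup_(p in [set p | exists g, chart p g])
    (rat_ball p `&` partial i f @^-1` Y)).
  apply: measurable_bigcup_count => p [g pg].
  have [_ [L L0 gL] _] := pg.
  rewrite [X in measurable X](_ : _ = rat_ball p `&` partial i g @^-1` Y).
    apply: measurableI; first exact: measurable_rV_ball.
    rewrite -[X in measurable X]setTI.
    exact: (measurable_partial_lipschitz i gL measurableT mY).
  by apply/seteqP; split => x [px] /= fY; split => //; move: fY;
    rewrite /partial (near_eq_derive _ (chart_near pg px)).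
apply/seteqP; split => [x [Ox fY]|x [p [g [pO _ _]] [px fY]]].
  by have [p [g [pg px]]] := chart_cover Ox; exists p => //; exists g.
by split => //; exact: pO.
Qed.

Lemma loclip_measurable : measurable_fun Omega f.
Proof.
by apply: continuous_measurable_rV => // x /fO; exact: loclip_continuous.
Qed.

End local_lipschitz_partial.

(** * The divergence theorem for fields vanishing on the boundary *)

Section divergence_theorem.
Context {R : realType} {n : nat}.
Variable Omega : set 'rV[R]_n.
Hypotheses (oO : open Omega) (bO : bounded_set Omega).
Implicit Types (f zeta eta V : 'rV[R]_n -> R) (x y : 'rV[R]_n).
Notation leb := (lebesgue_rV n).

Let bound : exists r : R, forall x, Omega x -> `|x| <= r.
Proof.
have [M [_ MO]] := bO; exists (M + 1) => x Ox.
by apply: MO => //; rewrite ltrDl.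
Qed.

Let mO : measurable Omega.
Proof. exact: open_measurable_rV. Qed.

Lemma bounded_domain_finite : (leb Omega < +oo)%E.
Proof. by have [r rO] := bound; exact: lebesgue_rV_bounded mO rO. Qed.

(** The flux of a compactly supported field vanishes: extended by zero, the
    field is Lipschitz on the whole space. *)
Lemma integral_partial_compact zeta V (i : 'I_n) :
  (forall x, Omega x -> loclip_at zeta x) ->
  (forall x, Omega x -> loclip_at V x) ->
  (forall x, bdry Omega x -> \forall y \near x, Omega y -> zeta y = 0) ->
  leb.-integrable Omega (EFin \o partial i (fun y => zeta y * V y)) /\
  (\int[leb]_(x in Omega) (partial i (fun y => zeta y * V y) x)%:E = 0)%E.
Proof.
move=> zl Vl z0; pose F y := zeta y * V y; pose G := F \_ Omega.
have GO x : Omega x -> \forall y \near x, F y = G y.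
  move=> Ox; have : nbhs x Omega by exact: open_nbhs_nbhs.
  by apply: filterS => y Oy; rewrite /G patchE mem_set.
have G0 x : ~ Omega x -> \forall y \near x, G y = 0.
  move=> Ox; have [cx|cx] := pselect (closure Omega x).
    have := z0 x (conj cx Ox); apply: filterS => y Oy.
    by rewrite /G patchE; case: ifPn => // /set_mem /Oy; rewrite /F => ->; rewrite mul0r.
  have : nbhs x (~` closure Omega).
    by apply: open_nbhs_nbhs; split => //; exact: closed_openC (@closed_closure _ _).
  apply: filterS => y cy; rewrite /G patchE; case: ifPn => // /set_mem Oy.
  by exfalso; apply: cy; exact: subset_closure.
have Gl x : loclip_at G x.
  have [Ox|Ox] := pselect (Omega x).
    by apply: near_eq_loclip (GO x Ox) _; apply: loclipM; [exact: zl|exact: Vl].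
  apply: near_eq_loclip (loclip_cst 0 x).
  by apply: filterS (G0 x Ox) => y ->.
have [r rO] := bound.
have Gr x : r + 1 <= `|x| -> G x = 0.
  move=> xr; rewrite /G patchE; case: ifPn => // /set_mem /rO xr'.
  by have := le_trans xr xr'; rewrite gerDl ler10.
have [L' L'P] := loclip_compact_lipschitz Gl Gr.
pose L := Num.max L' 0.
have L0 : 0 <= L by rewrite le_max lexx orbT.
have LP : lipschitz_with L G.
  by move=> x y; apply: le_trans (L'P _ _) _; rewrite ler_wpM2r// le_max lexx.
have PG x : Omega x -> partial i G x = partial i F x.
  by move=> Ox; apply/esym/near_eq_derive; exact: GO.
have intG := integrable_partial_lipschitz i L0 LP Gr.
split.
  apply: (@eq_integrable _ _ _ _ _ mO (EFin \o partial i G)).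
    by move=> x /set_mem Ox /=; rewrite PG.
  by apply: integrableS intG.
rewrite -[RHS](integral_partial_lipschitz i L0 LP Gr).
rewrite [LHS]integral_mkcond; apply: eq_integral => x _.
rewrite patchE; case: ifPn => [/set_mem Ox|/negP Ox]; first by rewrite PG.
congr EFin; rewrite -(derive_cst (0 : R) x (delta_mx 0 i)).
apply/esym/near_eq_derive; apply: G0 => Ox'; apply: Ox; exact/mem_set.
Qed.

(** The truncation at height e of eta, which has compact support when eta
    vanishes on the boundary. *)
Definition truncation (e : R) eta y : R :=
  Num.max (eta y - e) 0 - Num.max (- eta y - e) 0.

Lemma truncation_dist (e : R) eta x : 0 < e -> `|eta x - truncation e eta x| <= e.
Proof.
move=> e0; rewrite /truncation ler_norml.
by case: (leP _ 0) => ?; case: (leP _ 0) => ?; lra.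
Qed.

Lemma truncation_le (e : R) eta x : 0 < e -> `|truncation e eta x| <= `|eta x|.
Proof.
move=> e0; rewrite /truncation ler_norml.
have := ler_norm (eta x); have := ler_norm (- eta x); rewrite normrN => ? ?.
by case: (leP _ 0) => ?; case: (leP _ 0) => ?; lra.
Qed.

Lemma loclip_truncation (e : R) eta x : loclip_at eta x ->
  loclip_at (truncation e eta) x.
Proof.
move=> ex; apply: loclipB.
  apply: (loclip_comp (h := fun s => Num.max s 0)); first exact: loclip_max0.
  by apply: loclipB => //; exact: loclip_cst.
apply: (loclip_comp (h := fun s => Num.max s 0)); first exact: loclip_max0.
by apply: loclipB; [exact: loclipN|exact: loclip_cst].
Qed.

Lemma truncation_bdry (e : R) eta x : 0 < e ->
  eta y @[y --> within Omega (nbhs x)] --> (0 : R) ->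
  \forall y \near x, Omega y -> truncation e eta y = 0.
Proof.
move=> e0 /cvgrPdist_lt/(_ e e0); rewrite near_withinE.
apply: filterS => y ey /ey; rewrite sub0r normrN ltr_norml => /andP[? ?].
by rewrite /truncation; case: (leP _ 0) => ?; case: (leP _ 0) => ?; lra.
Qed.

(** Derivability of both positive parts, and not just of their difference:
    this is what makes each of them fall under [derive_max0]. *)
Definition truncation_derivable (e : R) eta x v :=
  derivable (fun y => Num.max (eta y - e) 0) x v /\
  derivable (fun y => Num.max (- eta y - e) 0) x v.

(** For e = 0 the truncation is eta itself, and the formula says that the
    derivative of eta vanishes where eta does. *)
Lemma is_derive_truncation (e : R) eta x v : 0 <= e -> loclip_at eta x ->
  derivable eta x v -> truncation_derivable e eta x v ->
  is_derive x v (truncation e eta) (if e < `|eta x| then 'D_v eta x else 0).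
Proof.
move=> e0 el ed [pd qd].
have d1 : is_derive x v (fun y => eta y - e) ('D_v eta x).
  by rewrite -[X in is_derive _ _ _ X]subr0; apply: is_deriveB.
have d2 : is_derive x v (fun y => - eta y - e) (- 'D_v eta x).
  rewrite -[X in is_derive _ _ _ X]subr0; apply: is_deriveB.
  by apply: is_deriveN; exact/derivableP.
have [d1d d1E] := d1; have [d2d d2E] := d2.
have c1 : {for x, continuous (fun y => eta y - e)}.
  by apply: loclip_continuous; apply: loclipB => //; exact: loclip_cst.
have c2 : {for x, continuous (fun y => - eta y - e)}.
  by apply: loclip_continuous; apply: loclipB; [exact: loclipN|exact: loclip_cst].
have dp : is_derive x v (fun y => Num.max (eta y - e) 0)
    (if 0 < eta x - e then 'D_v eta x else 0).
  by split; [exact: pd|rewrite (derive_max0 c1 d1d pd) d1E].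
have dq : is_derive x v (fun y => Num.max (- eta y - e) 0)
    (if 0 < - eta x - e then - 'D_v eta x else 0).
  by split; [exact: qd|rewrite (derive_max0 c2 d2d qd) d2E].
apply: is_derive_eq (is_deriveB dp dq) _.
have := ler_norm (eta x); have := ler_norm (- eta x); rewrite normrN => h1 h2.
have [h3|h3] := ltP e `|eta x|.
  have [h4|h4] := leP 0 (eta x).
    rewrite ger0_norm// in h3; rewrite ifT ?ifF ?subr0//; last by lra.
    by apply/negbTE; rewrite -leNgt; lra.
  rewrite ltr0_norm// in h3; rewrite ifF ?ifT ?sub0r ?opprK//; first lra.
  by apply/negbTE; rewrite -leNgt; lra.
by rewrite !ifF ?subr0//; apply/negbTE; rewrite -leNgt; lra.
Qed.

Variables (eta : 'rV[R]_n -> R) (V : 'I_n -> 'rV[R]_n -> R) (C : R).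
Hypotheses (etal : forall x, Omega x -> loclip_at eta x)
  (Vl : forall i x, Omega x -> loclip_at (V i) x)
  (eta0 : forall x, bdry Omega x ->
     eta y @[y --> within Omega (nbhs x)] --> (0 : R))
  (dV : forall i x, Omega x -> derivable (V i) x (delta_mx 0 i))
  (etaC : forall x, Omega x -> `|eta x| <= C)
  (VC : forall i x, Omega x -> `|V i x| <= C)
  (divC : forall x, Omega x -> `|\sum_i partial i (V i) x| <= C)
  (gradC : {ae leb, forall x, Omega x -> forall i, `|partial i eta x| <= C}).

Let Q x := \sum_i partial i eta x * V i x + eta x * \sum_i partial i (V i) x.

Let ep (k : nat) : R := k.+1%:R^-1.

Let ep_gt0 k : 0 < ep k.
Proof. by rewrite invr_gt0 ltr0n. Qed.

Let h k x := \sum_i partial i (fun y => truncation (ep k) eta y * V i y) x.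

Let zl k x : Omega x -> loclip_at (truncation (ep k) eta) x.
Proof. by move=> /etal; exact: loclip_truncation. Qed.

Let z0 k x : bdry Omega x ->
  \forall y \near x, Omega y -> truncation (ep k) eta y = 0.
Proof. by move=> /eta0; exact: truncation_bdry. Qed.

Let int_h k : (\int[leb]_(x in Omega) (h k x)%:E = 0)%E.
Proof.
pose H i := EFin \o partial i (fun y => truncation (ep k) eta y * V i y).
have Hi i := integral_partial_compact i (@zl k) (Vl i) (@z0 k).
transitivity (\int[leb]_(x in Omega) \sum_i H i x)%E.
  by apply: eq_integral => x _; rewrite /h -sumEFin.
rewrite integral_sum//; last by move=> i; exact: (Hi i).1.
by apply: big1 => i _; exact: (Hi i).2.
Qed.

Let ae_derivable : {ae leb, forall x, Omega x -> forall i,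
  [/\ derivable eta x (delta_mx 0 i),
      truncation_derivable 0 eta x (delta_mx 0 i) &
      forall k, truncation_derivable (ep k) eta x (delta_mx 0 i)]}.
Proof.
have F := ae_filter_ringOfSetsType leb.
have T e : {ae leb, forall x, forall i, Omega x ->
    truncation_derivable e eta x (delta_mx 0 i)}.
  apply: filter_forall => i.
  have max0 (f : 'rV[R]_n -> R) : (forall x, Omega x -> loclip_at f x) ->
      {ae leb, forall x, Omega x ->
        derivable (fun y => Num.max (f y) 0) x (delta_mx 0 i)}.
    move=> fl; apply: loclip_derivable_ae => // x Ox.
    apply: (loclip_comp (h := fun s => Num.max s 0)); first exact: loclip_max0.
    exact: fl.
  have A : {ae leb, forall x, Omega x ->
      derivable (fun y => Num.max (eta y - e) 0) x (delta_mx 0 i)}.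
    by apply: max0 => x Ox; apply: loclipB; [exact: etal|exact: loclip_cst].
  have B : {ae leb, forall x, Omega x ->
      derivable (fun y => Num.max (- eta y - e) 0) x (delta_mx 0 i)}.
    apply: max0 => x Ox; apply: loclipB; last exact: loclip_cst.
    by apply: loclipN; exact: etal.
  by apply: filterS2 A B => x a b Ox; split; [exact: a|exact: b].
have D : {ae leb, forall x, forall i, Omega x -> derivable eta x (delta_mx 0 i)}.
  by apply: filter_forall => i; exact: loclip_derivable_ae.
have TT : {ae leb, forall x, forall k, forall i, Omega x ->
    truncation_derivable (ep k) eta x (delta_mx 0 i)}.
  by apply: ae_foralln => k; exact: T.
apply: filterS3 D (T 0) TT => x d t tt Ox i.
by split; [exact: d|exact: t|move=> k; exact: tt].
Qed.

(** The chain rule for the truncations, and the fact that the gradient of eta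
    vanishes almost everywhere on the zero set of eta. *)
Let h_formula : {ae leb, forall x, Omega x ->
  (eta x = 0 -> forall i, partial i eta x = 0) /\
  forall k, h k x = (if ep k < `|eta x| then
      \sum_i partial i eta x * V i x else 0) +
    truncation (ep k) eta x * \sum_i partial i (V i) x}.
Proof.
apply: filterS ae_derivable => x dx Ox.
split.
  move=> ex i; have [ed td _] := dx Ox i.
  have [_] := is_derive_truncation (lexx 0) (etal Ox) ed td.
  rewrite ex normr0 ltxx => <-; rewrite (_ : truncation 0 eta = eta)//.
  apply/funext => y; rewrite /truncation !subr0.
  by case: (leP _ 0) => ?; case: (leP _ 0) => ?; lra.
move=> k; rewrite /h mulr_sumr.
have -> : (if ep k < `|eta x| then \sum_i partial i eta x * V i x else 0) =
    \sum_i ((if ep k < `|eta x| then partial i eta x else 0) * V i x).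
  by case: ifP => // _; rewrite big1// => i _; rewrite mul0r.
rewrite -big_split /=; apply: eq_bigr => i _.
have [ed _ /(_ k) td] := dx Ox i.
have tD := is_derive_truncation (ltW (ep_gt0 k)) (etal Ox) ed td.
have VD : is_derive x (delta_mx 0 i) (V i) (partial i (V i) x).
  by apply/derivableP; exact: dV.
have [_] := is_deriveM tD VD; rewrite /partial => ->.
by rewrite addrC /GRing.scale /= (mulrC (V i x)).
Qed.

Let mV i : measurable_fun Omega (V i).
Proof. by apply: loclip_measurable => // x; exact: Vl. Qed.

Let mQ : measurable_fun Omega Q.
Proof.
apply: measurable_funD.
  apply: measurable_sum => i; apply: measurable_funM; last exact: mV.
  by apply: loclip_measurable_partial => // x; exact: etal.
apply: measurable_funM; first exact: loclip_measurable.
by apply: measurable_sum => i; apply: loclip_measurable_partial => // x; exact: Vl.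
Qed.

Let mh k : measurable_fun Omega (h k).
Proof.
apply: measurable_sum => i; apply: loclip_measurable_partial => // x Ox.
by apply: loclipM; [exact: zl|exact: Vl].
Qed.

(** The divergence theorem for a field vanishing on the boundary of a bounded
    open set of arbitrary shape. *)
Lemma integral_divergence :
  leb.-integrable Omega (EFin \o Q) /\
  (\int[leb]_(x in Omega) (Q x)%:E = 0)%E.
Proof.
have F := ae_filter_ringOfSetsType leb.
pose M := n%:R * (C * C) + C * C.
have gint : leb.-integrable Omega (cst M%:E).
  rewrite (_ : cst M%:E = EFin \o cst M)//.
  apply: (@bounded_integrable _ _ _ _ _ _ `|M|) => //.
  exact: bounded_domain_finite.
have hb : {ae leb, forall x k, Omega x -> (`|(h k x)%:E| <= cst M%:E x)%E}.
  apply: filterS2 h_formula gradC => x hx gx k Ox.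
  have [_ ->] := hx Ox; have C0 : 0 <= C by apply: le_trans (etaC Ox).
  rewrite lee_fin; apply: le_trans (ler_normD _ _) _; apply: lerD.
    case: ifP => _; last by rewrite normr0 mulr_ge0// mulr_ge0.
    apply: le_trans (ler_norm_sum _ _ _) _.
    have -> : n%:R * (C * C) = \sum_(i < n) C * C.
      by rewrite sumr_const card_ord mulr_natl.
    apply: ler_sum => i _; rewrite normrM ler_pM//; [exact: gx|exact: VC].
  rewrite normrM ler_pM//; last exact: divC.
  by apply: le_trans (truncation_le _ _ (ep_gt0 k)) _; exact: etaC.
have hQ : {ae leb, forall x, Omega x -> (h k x)%:E @[k --> \oo] --> (Q x)%:E}.
  apply: filterS h_formula => x hx Ox; have [e0 hE] := hx Ox.
  apply: cvg_EFin; first exact: nearW.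
  rewrite (_ : _ \o _ = h^~ x)//.
  have tr : truncation (ep k) eta x @[k --> \oo] --> eta x.
    apply/cvgrPdist_lt => e egt0; near=> k.
    apply: le_lt_trans (truncation_dist _ _ (ep_gt0 k)) _.
    by near: k; exact: near_infty_natSinv_lt (PosNum egt0).
  rewrite (_ : h^~ x = fun k => (if ep k < `|eta x| then
      \sum_i partial i eta x * V i x else 0) +
    truncation (ep k) eta x * \sum_i partial i (V i) x); last first.
    by apply/funext => k; rewrite hE.
  apply: cvgD; last by apply: cvgM => //; exact: cvg_cst.
  have [ex|ex] := eqVneq (eta x) 0.
    rewrite big1; last by move=> i _; rewrite e0// mul0r.
    by under eq_fun do rewrite if_same; exact: cvg_cst.
  have ex0 : 0 < `|eta x| by rewrite normr_gt0.
  apply: cvg_near_cst; near=> k; rewrite ifT//.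
  by near: k; exact: near_infty_natSinv_lt (PosNum ex0).
have mh' k : measurable_fun Omega (EFin \o h k) by exact/measurable_EFinP.
have mQ' : measurable_fun Omega (EFin \o Q) by exact/measurable_EFinP.
have [Qint _ Qlim] := dominated_convergence mO mh' mQ' hQ gint hb.
split => //; rewrite -(cvg_lim _ Qlim)//.
rewrite (_ : (fun _ => _) = cst 0%E) ?lim_cst//.
by apply/funext => k; exact: int_h.
Unshelve. all: by end_near. Qed.

End divergence_theorem.

(** * Behaviour at the boundary and the reverse Cauchy-Schwarz inequality *)

Section extension_by_continuity.
Context {R : realType} {n : nat}.
Variable Omega : set 'rV[R]_n.
Implicit Types (f : 'rV[R]_n -> R) (x y : 'rV[R]_n).

Lemma extensionE (T : ptopologicalType) (f : 'rV[R]_n -> T) x : Omega x ->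
  extension Omega f x = f x.
Proof. by move=> Ox; rewrite /extension /patch mem_set. Qed.

Lemma cvg_within_bounded f x (l : R) :
  f y @[y --> within Omega (nbhs x)] --> l ->
  exists M : R, \forall y \near x, Omega y -> `|f y| <= M.
Proof.
move=> /cvgrPdist_lt/(_ _ ltr01) fl; exists (`|l| + 1).
rewrite near_withinE in fl; apply: filterS fl => y fy /fy {}fy.
rewrite -lerBlDl; apply: le_trans (ltW fy); rewrite distrC.
exact: lerB_dist.
Qed.

(** The closure is compact, so local bounds near its points give a global
    one. *)
Lemma bounded_near_closure f : bounded_set Omega ->
  (forall x, closure Omega x ->
    exists M : R, \forall y \near x, Omega y -> `|f y| <= M) ->
  exists M : R, forall y, Omega y -> `|f y| <= M.
Proof.
move=> [r [_ rO]] fM.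
have cb : bounded_set (closure Omega).
  exists (r + 1); split; first exact: num_real.
  move=> s rs x cx.
  have [y [Oy xy]] := cx _ (nbhsx_ballx x 1 ltr01).
  have yr : `|y| <= r + (s - r - 1) by apply: rO => //; lra.
  rewrite -ball_normE /= in xy.
  have := ler_normD (x - y) y; rewrite subrK => /le_trans; apply; lra.
have cK := bounded_closed_compact cb (@closed_closure _ _).
have /compact_near_coveringP/(_ _ (+oo : set_system R)
  (fun k y => Omega y -> `|f y| <= k)) cov := cK.
have : \forall k \near +oo, closure Omega `<=` (fun y => Omega y -> `|f y| <= k).
  apply: cov => x cx; have [M fx] := fM x cx.
  near=> y k => /= Oy; apply: (@le_trans _ _ M).
    by move: Oy; near: y.
  by near: k; apply: nbhs_pinfty_ge; exact: num_real.
move=> [N [_ NP]]; exists (N + 1) => y Oy.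
by apply: (NP (N + 1)) => //; [rewrite ltrDl|exact: subset_closure].
Unshelve. all: by end_near. Qed.

Lemma cvg_coord (F : set_system 'rV[R]_n) {PF : ProperFilter F}
    (f : 'rV[R]_n -> 'rV[R]_n) (l : 'rV[R]_n) :
  (forall i, f y 0 i @[y --> F] --> l 0 i) -> f y @[y --> F] --> l.
Proof.
move=> fl; apply/cvgrPdist_le => e e0.
have : \forall y \near F, forall i, `|l 0 i - f y 0 i| <= e.
  by apply: filter_forall => i; move/cvgrPdist_le : (fl i); exact.
apply: filterS => y fy; apply: normr_rV_le; first exact: ltW.
by move=> i; rewrite !mxE.
Qed.

End extension_by_continuity.

Section euclidean.
Context {R : realType} {n : nat}.
Implicit Types (p q : 'rV[R]_n).

Lemma sqr_euclid_norm p : euclid_norm p ^+ 2 = \sum_i p 0 i ^+ 2.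
Proof. by rewrite sqr_sqrtr// sumr_ge0// => i _; rewrite sqr_ge0. Qed.

Lemma euclid_norm_ge0 p : 0 <= euclid_norm p.
Proof. exact: sqrtr_ge0. Qed.

Lemma coord_le_euclid_norm p i : `|p 0 i| <= euclid_norm p.
Proof.
rewrite -sqrtr_sqr ler_sqrt ?sumr_ge0//; last by move=> j _; rewrite sqr_ge0.
by rewrite (bigD1 i)//= lerDl sumr_ge0// => j _; rewrite sqr_ge0.
Qed.

Lemma euclid_norm_lt1 p : euclid_norm p < 1 -> 0 < 1 - euclid_norm p ^+ 2.
Proof.
by move=> p1; rewrite subr_gt0 expr_lt1// euclid_norm_ge0.
Qed.

(** The reverse Cauchy-Schwarz inequality for the causal vectors (p, 1) and
    (q, 1), as an instance of 2 a b <= a^2 + b^2. *)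
Lemma reverse_cauchy_schwarz p q : euclid_norm p <= 1 -> euclid_norm q <= 1 ->
  Num.sqrt (1 - euclid_norm p ^+ 2) * Num.sqrt (1 - euclid_norm q ^+ 2) +
  (\sum_i (p 0 i - q 0 i) ^+ 2) / 2 <= 1 - \sum_i p 0 i * q 0 i.
Proof.
move=> p1 q1.
have sq (v : 'rV[R]_n) : euclid_norm v <= 1 -> Num.sqrt (1 - euclid_norm v ^+ 2) ^+ 2 =
    1 - \sum_i v 0 i ^+ 2.
  move=> v1; rewrite -sqr_euclid_norm; apply: sqr_sqrtr.
  by rewrite subr_ge0 expr_le1// euclid_norm_ge0.
have -> : \sum_i (p 0 i - q 0 i) ^+ 2 = \sum_i p 0 i ^+ 2 +
    \sum_i q 0 i ^+ 2 - 2 * \sum_i p 0 i * q 0 i.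
  rewrite mulr_sumr -big_split -sumrB /=; apply: eq_bigr => i _.
  by rewrite sqrrB mulr_natl addrAC.
have := sq p p1; have := sq q q1.
set a := Num.sqrt _; set b := Num.sqrt _ => Hb Ha.
have := sqr_ge0 (a - b); rewrite sqrrB; lra.
Qed.

End euclidean.

(** * The calibrating vector field of a solution *)

Section smooth_solution.
Context {R : realType} {n : nat}.
Variables (Omega : set 'rV[R]_n) (u : 'rV[R]_n -> R).
Hypotheses (oO : open Omega) (bO : bounded_set Omega)
  (u_smooth : smooth_on_closure Omega u)
  (u_spacelike : forall x, closure Omega x ->
     euclid_norm (extension Omega (grad u) x) < 1).
Implicit Types (x y : 'rV[R]_n).

(** The time component of the unit normal to the graph of u. *)
Definition lorentz_factor y : R := (Num.sqrt (1 - euclid_norm (grad u y) ^+ 2))^-1.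

(** The field whose divergence is the left-hand side of the equation. *)
Definition mean_curvature_field (i : 'I_n) y : R :=
  lorentz_factor y * partial i u y.

Let differentiable_iter (s : seq 'I_n) x : Omega x ->
  differentiable (foldr partial u s) x.
Proof. by move=> Ox; have [sm _ _] := u_smooth; exact: sm. Qed.

Let loclip_iter (s : seq 'I_n) x : Omega x -> loclip_at (foldr partial u s) x.
Proof.
move=> Ox; apply: (C1_loclip oO) Ox => [y Oy|i y Oy].
  exact: differentiable_iter.
exact: differentiable_continuous (differentiable_iter (i :: s) Oy).
Qed.

Lemma loclip_solution x : Omega x -> loclip_at u x.
Proof. exact: (loclip_iter [::]). Qed.

Lemma derivable_solution i x : Omega x -> derivable u x (delta_mx 0 i).
Proof. by move=> Ox; apply/diff_derivable/(differentiable_iter [::]). Qed.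

Lemma loclip_partial_solution i x : Omega x -> loclip_at (partial i u) x.
Proof. exact: (loclip_iter [:: i]). Qed.

Lemma grad_lt1 x : Omega x -> euclid_norm (grad u x) < 1.
Proof.
move=> Ox; have := u_spacelike (subset_closure Ox).
by rewrite extensionE.
Qed.

Let radicand y : R := 1 - \sum_i partial i u y * partial i u y.

Let radicandE y : 1 - euclid_norm (grad u y) ^+ 2 = radicand y.
Proof.
rewrite sqr_euclid_norm; congr (1 - _); apply: eq_bigr => i _.
by rewrite mxE expr2.
Qed.

Let radicand_gt0 x : Omega x -> 0 < radicand x.
Proof. by move=> /grad_lt1 /euclid_norm_lt1; rewrite radicandE. Qed.

Lemma lorentz_factor_gt0 x : Omega x -> 0 < lorentz_factor x.
Proof.
by move=> /grad_lt1 /euclid_norm_lt1 ?; rewrite invr_gt0 sqrtr_gt0.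
Qed.

Lemma loclip_lorentz_factor x : Omega x -> loclip_at lorentz_factor x.
Proof.
move=> Ox.
rewrite (_ : lorentz_factor = fun y => (Num.sqrt (radicand y))^-1); last first.
  by apply/funext => y; rewrite /lorentz_factor radicandE.
apply: (loclip_comp (h := fun s => (Num.sqrt s)^-1)).
  exact/loclip_invsqrt/radicand_gt0.
apply: loclipB; first exact: loclip_cst.
apply: loclip_sum => i; apply: loclipM; exact: loclip_partial_solution.
Qed.

Lemma loclip_field i x : Omega x -> loclip_at (mean_curvature_field i) x.
Proof.
move=> Ox; apply: loclipM; first exact: loclip_lorentz_factor.
exact: loclip_partial_solution.
Qed.

Lemma derivable_field i x : Omega x ->
  derivable (mean_curvature_field i) x (delta_mx 0 i).
Proof.
move=> Ox; pose e : 'rV[R]_n := delta_mx 0 i.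
have dp j : derivable (partial j u) x e.
  exact/diff_derivable/(differentiable_iter [:: j]).
apply: derivableM; last exact: dp.
rewrite (_ : lorentz_factor = fun y => (Num.sqrt (radicand y))^-1); last first.
  by apply/funext => y; rewrite /lorentz_factor radicandE.
apply: derivableV; first by rewrite gt_eqF// sqrtr_gt0 radicand_gt0.
have dr : derivable radicand x e.
  apply: derivableB; first exact: derivable_cst.
  rewrite (_ : (fun y => _) = \sum_i (partial i u * partial i u)).
    by apply: derivable_sum => j; apply: derivableM.
  by apply/funext => y; rewrite fct_sumE.
have hr := is_derive1_sqrt (radicand_gt0 Ox).
by have [] := is_derive_compR hr (derivableP dr).
Qed.

(** The limits of the gradient at the boundary are still spacelike, and the
    closure is compact. *)
Lemma lorentz_factor_bounded : exists M : R, forall x, Omega x ->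
  `|lorentz_factor x| <= M.
Proof.
apply: (bounded_near_closure bO) => x cx.
have [Ox|Ox] := pselect (Omega x).
  have [M Mx] := loclip_bounded (loclip_lorentz_factor Ox).
  by exists M; apply: filterS Mx => y yM _.
have [_ smb _] := u_smooth.
have bx : bdry Omega x by [].
have PF : ProperFilter (within Omega (nbhs x)) by exact: within_nbhs_proper.
pose l : 'rV[R]_n := \row_i lim (partial i u y @[y --> within Omega (nbhs x)]).
have li i : partial i u y @[y --> within Omega (nbhs x)] --> l 0 i.
  by rewrite mxE; exact: (smb [:: i] x bx).
have gl : grad u y @[y --> within Omega (nbhs x)] --> l.
  by apply: cvg_coord => i; under eq_fun do rewrite mxE; exact: li.
have l1 : euclid_norm l < 1.
  have := u_spacelike cx; rewrite /extension /patch memNset//.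
  by rewrite (cvg_lim _ gl)//; exact: norm_hausdorff.
have r0 := euclid_norm_lt1 l1.
have cs (s : seq 'I_n) : \sum_(i <- s) partial i u y * partial i u y
    @[y --> within Omega (nbhs x)] --> \sum_(i <- s) l 0 i * l 0 i.
  elim: s => [|i s IH].
    by under eq_fun do rewrite big_nil; rewrite big_nil; exact: cvg_cst.
  under eq_fun do rewrite big_cons; rewrite big_cons; apply: cvgD => //.
  by apply: cvgM; exact: li.
have rc : radicand y @[y --> within Omega (nbhs x)] --> 1 - euclid_norm l ^+ 2.
  rewrite sqr_euclid_norm; apply: cvgB; first exact: cvg_cst.
  exact: cs.
have sc := cvg_comp _ _ rc (@sqrt_continuous R _).
apply: (@cvg_within_bounded _ _ _ _ _ (Num.sqrt (1 - euclid_norm l ^+ 2))^-1).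
rewrite (_ : lorentz_factor = fun y => (Num.sqrt (radicand y))^-1); last first.
  by apply/funext => y; rewrite /lorentz_factor radicandE.
by apply: cvgV; [rewrite gt_eqF// sqrtr_gt0|exact: sc].
Qed.

Lemma solution_bounded : exists M : R, forall x, Omega x -> `|u x| <= M.
Proof.
apply: (bounded_near_closure bO) => x cx.
have [Ox|Ox] := pselect (Omega x).
  have [M Mx] := loclip_bounded (loclip_solution Ox).
  by exists M; apply: filterS Mx => y yM _.
have [_ _ ub] := u_smooth.
by apply: cvg_within_bounded; apply: ub; split.
Qed.

Lemma field_le i x : Omega x ->
  `|mean_curvature_field i x| <= `|lorentz_factor x|.
Proof.
move=> Ox; rewrite normrM ler_piMr//.
have := coord_le_euclid_norm (grad u x) i; rewrite mxE => /le_trans; apply.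
exact: ltW (grad_lt1 Ox).
Qed.

Hypothesis u_eq : forall x, closure Omega x ->
  extension Omega (divergence (fun y =>
    (Num.sqrt (1 - euclid_norm (grad u y) ^+ 2))^-1 *: grad u y)) x
  = (Num.sqrt (1 - euclid_norm (extension Omega (grad u) x) ^+ 2))^-1.

Lemma divergence_field x : Omega x ->
  \sum_i partial i (mean_curvature_field i) x = lorentz_factor x.
Proof.
move=> Ox; have := u_eq (subset_closure Ox); rewrite !extensionE// => divE.
rewrite /lorentz_factor -divE.
apply: eq_bigr => i _; congr (partial i _ x); apply/funext => y.
by rewrite !mxE.
Qed.

End smooth_solution.

(** * Uniqueness from the gradient *)

Section comparison.
Context {R : realType} {n : nat}.
Variables (Omega : set 'rV[R]_n).
Hypotheses (oO : open Omega) (bO : bounded_set Omega).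
Implicit Types (u v w : 'rV[R]_n -> R) (x y : 'rV[R]_n).
Notation leb := (lebesgue_rV n).

Let mO : measurable Omega.
Proof. exact: open_measurable_rV. Qed.

Lemma locally_lipschitz_loclip w x :
  [locally [lipschitz (w x : R^o) | x in Omega]] -> Omega x -> loclip_at w x.
Proof.
move=> wl Ox; have := wl (x, x) (conj Ox Ox).
move=> /(filterI (nbhs_pinfty_gt (num_real 0)))[N [_ NP]].
have [|_ MP] := NP (N + 1); first by rewrite ltrDl.
have [[A B] [xA xB] AB] := MP.
exists (N + 1), (A `&` B `&` Omega).
  by apply: filterI; [exact: filterI|exact: open_nbhs_nbhs].
move=> y z [[yA yB] Oy] [[zA zB] Oz].
exact: (AB (y, z) (conj yA zB) (conj Oy Oz)).
Qed.

Lemma graph_bounded w : bounded_set (graph Omega w) ->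
  exists M : R, forall x, Omega x -> `|w x| <= M.
Proof.
move=> [N [_ NP]]; exists (N + 1) => x Ox.
have wx : `|w x| <= `|(x, w x)| by rewrite prod_normE le_max lexx orbT.
by apply: le_trans wx (NP (N + 1) _ (x, w x) (conj Ox erefl)); rewrite ltrDl.
Qed.

(** A continuous function that vanishes almost everywhere on an open set
    vanishes there, as balls have positive measure. *)
Lemma ae_eq0_continuous v : (forall x, Omega x -> {for x, continuous v}) ->
  {ae leb, forall x, Omega x -> v x = 0} -> forall x, Omega x -> v x = 0.
Proof.
move=> vc [N [mN N0 vN]] x Ox; apply: contrapT => vx.
have : \forall y \near x, Omega y /\ v y != 0.
  have nz : \forall y \near x, v y != 0.
    have vx0 : 0 < `|v x| by rewrite normr_gt0; exact/eqP.
    have /cvgrPdist_lt/(_ _ vx0) := vc x Ox; apply: filterS => y.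
    by apply: contraTneq => ->; rewrite subr0 ltxx.
  exact: filterS2 (open_nbhs_nbhs (conj oO Ox)) nz.
move=> /nbhs_ballP[e /= e0 eP].
pose a : 'rV[R]_n := \row_i (x 0 i - e / 2).
pose b : 'rV[R]_n := \row_i (x 0 i + e / 2).
have e2 : 0 < e / 2 by rewrite divr_gt0.
have ab i : a 0 i <= b 0 i by rewrite !mxE; lra.
have box := lebesgue_rV_box ab.
set B := [set y : 'rV[R]_n | _] in box.
have BN : B `<=` N.
  move=> y By; apply: vN => /= yv.
  have [|Oy /eqP] := eP y; last by move/(_ (yv Oy)).
  apply/ball_rVP => // i; have := By i; rewrite !mxE in_itv /= => ?.
  by rewrite ltr_norml; lra.
have mB : measurable B.
  rewrite [X in measurable X](_ : _ = \bigcap_(j in [set: 'I_n])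
      (rV_coord j @^-1` `[a 0 j, b 0 j]%classic)).
    apply: fin_bigcap_measurable => // j _; rewrite -[X in measurable X]setTI.
    by apply: measurable_rV_coord => //; exact: measurable_itv.
  by apply/seteqP; split => y /= By j; [move=> _; exact: By|exact: By].
have : (leb B <= leb N)%E by apply: le_measure; rewrite ?inE.
rewrite N0 box lee_fin leNgt prodr_gt0// => i _.
by rewrite !mxE; lra.
Qed.

(** A locally Lipschitz function with vanishing gradient and zero boundary
    values is zero: the flux of v^2 x_i e_i through the boundary is the
    integral of v^2. *)
Lemma vanishing_gradient v (M : R) (i0 : 'I_n) :
  (forall x, Omega x -> loclip_at v x) ->
  (forall x, Omega x -> `|v x| <= M) ->
  (forall x, bdry Omega x -> v y @[y --> within Omega (nbhs x)] --> (0 : R)) ->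
  {ae leb, forall x, Omega x -> forall i, partial i v x = 0} ->
  forall x, Omega x -> v x = 0.
Proof.
move=> vl vM v0 dv0.
have [r [_ rO]] := bO.
have xr x : Omega x -> `|x| <= r + 1 by move=> Ox; apply: rO => //; rewrite ltrDl.
pose eta x := v x * v x.
pose V (i : 'I_n) (x : 'rV[R]_n) : R := if i == i0 then x 0 i0 else 0.
pose C := Num.max (M * M) (Num.max (r + 1) 1).
have C1 : 1 <= C by rewrite /C !le_max lexx !orbT.
have C0 : 0 <= C by exact: le_trans C1.
have VD i x : is_derive x (delta_mx 0 i) (V i) (i == i0)%:R.
  rewrite /V; case: eqP => [->|_]; last exact: is_derive_cst.
  have H : (fun h : R => h^-1 *: (((fun y : 'rV[R]_n => y 0 i0) \o shift x)
      (h *: delta_mx 0 i0) - x 0 i0)) @ 0^' --> (1 : R).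
    apply: cvg_near_cst; near=> h.
    have hn : h != 0 by near: h; exact: nbhs_dnbhs_neq.
    by rewrite /= !mxE !eqxx mulr1 addrK /GRing.scale /= mulVf.
  split; first by apply/cvg_ex; exists 1.
  exact: cvg_lim H.
have VE i x : partial i (V i) x = (i == i0)%:R by case: (VD i x).
have divV x : \sum_i partial i (V i) x = 1.
  rewrite (bigD1 i0)//= VE eqxx big1 ?addr0// => i ii0.
  by rewrite VE (negbTE ii0).
have Vl i x : Omega x -> loclip_at (V i) x.
  move=> _; exists 1, setT; first exact: filterT.
  move=> y z _ _; rewrite mul1r /V; case: eqP => _; last by rewrite subrr normr0.
  by have := normr_coord (y - z) i0; rewrite !mxE.
have F := ae_filter_ringOfSetsType leb.
have dv : {ae leb, forall x, forall i, Omega x -> derivable v x (delta_mx 0 i)}.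
  by apply: filter_forall => i; exact: loclip_derivable_ae.
have deta : {ae leb, forall x, Omega x -> forall i, partial i eta x = 0}.
  apply: filterS2 dv0 dv => x dx vd Ox i.
  have vD : is_derive x (delta_mx 0 i) v 0.
    by split; [exact: vd|exact: dx].
  have [_] := is_deriveM vD vD; rewrite /partial => ->.
  by rewrite scaler0 addr0.
have [||||||||Qi Q0] := @integral_divergence R n Omega oO bO eta V C.
- by move=> x Ox; apply: loclipM; exact: vl.
- exact: Vl.
- by move=> x bx; rewrite -(mulr0 (0 : R)); apply: cvgM; exact: v0.
- by move=> i x _; case: (VD i x).
- move=> x Ox; rewrite normrM /C le_max; apply/orP; left.
  by apply: ler_pM => //; exact: vM.
- move=> i x Ox; rewrite /V; case: eqP => _; last by rewrite normr0.
  rewrite (le_trans (normr_coord _ _))// (le_trans (xr x Ox))//.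
  by rewrite /C !le_max lexx !orbT.
- by move=> x _; rewrite divV normr1.
- by apply: filterS deta => x dx Ox i; rewrite dx// normr0.
have mv : measurable_fun Omega eta.
  by apply: loclip_measurable => // x Ox; apply: loclipM; exact: vl.
have meta : measurable_fun Omega (EFin \o eta) by exact/measurable_EFinP.
have I0 : (\int[leb]_(x in Omega) `|(EFin \o eta) x| = 0)%E.
  rewrite -[RHS]Q0; apply: ae_eq_integral => //.
  - exact: measurableT_comp.
  - by case/integrableP: Qi.
  apply: filterS deta => x dx Ox; rewrite /= big1; last first.
    by move=> i _; rewrite dx// mul0r.
  by rewrite add0r divV mulr1 ger0_norm// /eta -expr2 sqr_ge0.
have /(ae_eq_integral_abs leb mO meta) etaz := I0.
have eta_c x : Omega x -> {for x, continuous eta}.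
  by move=> Ox; apply/loclip_continuous/loclipM; exact: vl.
move=> x Ox; have := ae_eq0_continuous eta_c _ Ox.
rewrite /eta => /(_ _)/eqP; rewrite mulf_eq0 orbb => H; apply/eqP/H.
by apply: filterS etaz => y + Oy => /(_ Oy) [].
Unshelve. all: by end_near. Qed.

End comparison.

(** * Calibration *)

Section weighted_volume.
Context {R : realType} {n : nat}.
Variables (Omega : set 'rV[R]_n).
Hypotheses (oO : open Omega) (bO : bounded_set Omega).
Implicit Types (u v w : 'rV[R]_n -> R) (x y : 'rV[R]_n).
Notation leb := (lebesgue_rV n).

Definition volume_density v x : R :=
  expR (- v x) * Num.sqrt (1 - euclid_norm (grad v x) ^+ 2).

Lemma volume_density_integrable v (M : R) :
  (forall x, Omega x -> loclip_at v x) ->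
  (forall x, Omega x -> `|v x| <= M) ->
  leb.-integrable Omega (EFin \o volume_density v).
Proof.
move=> vl vM; apply: (@bounded_integrable _ _ _ _ _ _ (expR M)).
- exact: open_measurable_rV.
- exact: bounded_domain_finite.
- apply: measurable_funM.
    apply: measurableT_comp; first exact: measurable_expR.
    by apply: measurableT_comp => //; exact: loclip_measurable.
  apply: measurableT_comp.
    by apply: continuous_measurable_fun; exact: sqrt_continuous.
  apply: measurable_funB; first exact: measurable_cst.
  rewrite (_ : (fun x => _) = fun x => \sum_i partial i v x ^+ 2); last first.
    apply/funext => x; rewrite sqr_euclid_norm; apply: eq_bigr => i _.
    by rewrite mxE.
  apply: measurable_sum => i; apply: measurable_funX.
  exact: loclip_measurable_partial.
- move=> x Ox; rewrite normrM -[leRHS]mulr1 ler_pM//.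
    rewrite ger0_norm ?expR_ge0// ler_expR.
    by have := vM x Ox; rewrite ler_norml => /andP[? _]; lra.
  (* also where |Dv| > 1, the square root of a negative number being 0 *)
  rewrite ger0_norm ?sqrtr_ge0// -[leRHS]sqrtr1 ler_wsqrtr//.
  by rewrite gerBl sqr_ge0.
Qed.

Lemma is_derive_expN v x e (dv : R) : is_derive x e v dv ->
  is_derive x e (fun y => expR (- v y)) (- expR (- v x) * dv).
Proof.
move=> vd; have vN : is_derive x e (fun y => - v y) (- dv) by exact: is_deriveN.
apply: is_derive_eq (is_derive_compR (is_derive_expR _) vN) _.
by rewrite mulrN mulNr.
Qed.

Lemma loclip_expN v x : loclip_at v x -> loclip_at (fun y => expR (- v y)) x.
Proof.
move=> vl; apply: (loclip_comp (h := expR)); first exact: loclip_expR.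
exact: loclipN.
Qed.

(** The algebra of the calibration inequality: a and b stand for the square
    roots for w and u, g for 1/b, c for the inner product of the gradients, S
    for half the squared distance of the gradients, e and e' for e^-w and
    e^-u. *)
Lemma gap_algebra (a b g S c e e' : R) : g * b = 1 -> a * b + S <= 1 - c ->
  0 < g -> 0 < e ->
  e * g * S <= g * (e * (1 - c) - e' * (1 - (1 - b ^+ 2))) - (e * a - e' * b).
Proof.
move=> gb abS g0 e0.
have -> : g * (e * (1 - c) - e' * (1 - (1 - b ^+ 2))) - (e * a - e' * b) =
    e * g * (1 - c - a * b) + (e * a - e' * b) * (g * b - 1) by ring.
by rewrite gb subrr mulr0 addr0 ler_pM2l ?mulr_gt0//; lra.
Qed.

Lemma ereal_gap (A B I : \bar R) : A \is a fin_num -> B \is a fin_num ->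
  (I = - (A - B))%E -> (0 <= I)%E -> (A <= B)%E /\ (A = B -> I = 0%E).
Proof.
move=> Af Bf; rewrite fin_num_oppeB// addeC => -> I0.
split; first by rewrite -sube_ge0// Af.
by move=> ->; rewrite subee.
Qed.

End weighted_volume.

Section calibration.
Context {R : realType} {n : nat}.
Variables (Omega : set 'rV[R]_n) (u w : 'rV[R]_n -> R).
Hypotheses (oO : open Omega) (bO : bounded_set Omega)
  (u_smooth : smooth_on_closure Omega u)
  (u_spacelike : forall x, closure Omega x ->
     euclid_norm (extension Omega (grad u) x) < 1)
  (u_eq : forall x, closure Omega x ->
     extension Omega (divergence (fun y =>
       (Num.sqrt (1 - euclid_norm (grad u y) ^+ 2))^-1 *: grad u y)) x
     = (Num.sqrt (1 - euclid_norm (extension Omega (grad u) x) ^+ 2))^-1)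
  (w_adm : admissible u Omega w)
  (w_bounded : bounded_set (graph Omega w)).
Implicit Types (x y : 'rV[R]_n).
Notation leb := (lebesgue_rV n).

Let mO : measurable Omega.
Proof. exact: open_measurable_rV. Qed.

Lemma loclip_admissible x : Omega x -> loclip_at w x.
Proof. by have [[wl _] _] := w_adm; exact: locally_lipschitz_loclip. Qed.

Lemma admissible_ae : {ae leb, forall x, Omega x ->
  euclid_norm (grad w x) <= 1 /\ forall i, derivable w x (delta_mx 0 i)}.
Proof.
have F := ae_filter_ringOfSetsType leb.
have dw : {ae leb, forall x, forall i, Omega x -> derivable w x (delta_mx 0 i)}.
  apply: filter_forall => i; apply: loclip_derivable_ae => //.
  exact: loclip_admissible.
have [[_ gw] _] := w_adm.
by apply: filterS2 gw dw => x gx dx Ox; split; [exact: gx|move=> i; exact: dx].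
Qed.

Let eta y := expR (- w y) - expR (- u y).

Let V := mean_curvature_field u.

Let Q x := \sum_i partial i eta x * V i x + eta x * \sum_i partial i (V i) x.

Let partial_eta i x : Omega x -> derivable w x (delta_mx 0 i) ->
  partial i eta x = - expR (- w x) * partial i w x + expR (- u x) * partial i u x.
Proof.
move=> Ox /derivableP/is_derive_expN dw.
have /derivableP/is_derive_expN du := derivable_solution u_smooth (i := i) Ox.
have [_] := is_deriveB dw du; rewrite /partial => ->.
by rewrite [in RHS]addrC !mulNr opprK addrC.
Qed.

(** All the factors of div(eta V) are bounded: u and the Lorentz factor because
    they extend to the compact closure, w and Dw by hypothesis. *)
Lemma calibration_flux :
  leb.-integrable Omega (EFin \o Q) /\ (\int[leb]_(x in Omega) (Q x)%:E = 0)%E.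
Proof.
have [Mw wM] := graph_bounded w_bounded.
have [Mu uM] := solution_bounded oO bO u_smooth.
have [Mg gM] := lorentz_factor_bounded oO bO u_smooth u_spacelike.
pose C := Num.max (expR Mw + expR Mu) Mg.
have eM v (M : R) x : `|v x| <= M -> expR (- v x) <= expR M.
  by rewrite ler_norml ler_expR => /andP[? _]; lra.
have F := ae_filter_ringOfSetsType leb.
apply: (@integral_divergence R n Omega oO bO eta V C).
- move=> x Ox; apply: loclipB; apply: loclip_expN.
    exact: loclip_admissible.
  exact: (loclip_solution oO u_smooth).
- by move=> i x Ox; exact: (loclip_field oO u_smooth u_spacelike).
- move=> x bx; have [_ wb] := w_adm; have [_ _ ub] := u_smooth.
  rewrite -(subrr (expR (- u x))); apply: cvgB.
    by apply: (cvg_comp _ _ (cvgN (wb x bx))); exact: continuous_expR.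
  by apply: (cvg_comp _ _ (cvgN (ub x bx))); exact: continuous_expR.
- by move=> i x Ox; exact: (derivable_field u_smooth u_spacelike).
- move=> x Ox; rewrite /C le_max; apply/orP; left.
  rewrite (le_trans (ler_normB _ _))// lerD// ger0_norm ?expR_ge0//.
    by apply: eM; exact: wM.
  by apply: eM; exact: uM.
- move=> i x Ox; rewrite /C le_max; apply/orP; right.
  apply: le_trans (gM x Ox); exact: (field_le u_spacelike).
- move=> x Ox; rewrite (divergence_field u_eq Ox) /C le_max gM//.
  by rewrite orbT.
- apply: filterS admissible_ae => x xw Ox i; have [wx dw] := xw Ox.
  rewrite partial_eta// /C le_max; apply/orP; left.
  apply: le_trans (ler_normD _ _) _; rewrite !normrM normrN.
  have le1 v : euclid_norm (grad v x) <= 1 -> `|partial i v x| <= 1.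
    by have := coord_le_euclid_norm (grad v x) i; rewrite mxE; exact: le_trans.
  have ux := ltW (grad_lt1 u_spacelike Ox).
  apply: lerD; rewrite -[leRHS]mulr1; apply: ler_pM => //.
  + by rewrite ger0_norm ?expR_ge0//; apply: eM; exact: wM.
  + exact: le1.
  + by rewrite ger0_norm ?expR_ge0//; apply: eM; exact: uM.
  + exact: le1.
Qed.

Let K x := Q x - (volume_density w x - volume_density u x).

(** The calibration inequality, with the defect that decides equality. *)
Let calibration_gap : {ae leb, forall x, Omega x ->
  expR (- w x) * lorentz_factor u x *
    (\sum_i (partial i w x - partial i u x) ^+ 2 / 2) <= K x}.
Proof.
apply: filterS admissible_ae => x xw Ox; have [wx dw] := xw Ox.
have ux := grad_lt1 u_spacelike Ox.
have g0 := lorentz_factor_gt0 u_spacelike Ox.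
have rcs := reverse_cauchy_schwarz wx (ltW ux).
pose pq := \sum_i partial i w x * partial i u x.
have qq : \sum_i partial i u x * partial i u x =
    1 - Num.sqrt (1 - euclid_norm (grad u x) ^+ 2) ^+ 2.
  rewrite sqr_sqrtr; last exact: ltW (euclid_norm_lt1 ux).
  rewrite opprB addrC subrK sqr_euclid_norm; apply: eq_bigr => i _.
  by rewrite mxE expr2.
have QE : Q x = lorentz_factor u x * (expR (- w x) * (1 - pq) - expR (- u x) *
    (1 - \sum_i partial i u x * partial i u x)).
  rewrite /Q (divergence_field u_eq Ox).
  have -> : \sum_i partial i eta x * V i x = lorentz_factor u x *
      (- expR (- w x) * pq + expR (- u x) *
        \sum_i partial i u x * partial i u x).
    rewrite /pq !mulr_sumr -big_split mulr_sumr; apply: eq_bigr => i _ /=.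
    by rewrite partial_eta// /V /mean_curvature_field; ring.
  by rewrite /eta; ring.
have rcs' : Num.sqrt (1 - euclid_norm (grad w x) ^+ 2) *
    Num.sqrt (1 - euclid_norm (grad u x) ^+ 2) +
    (\sum_i (partial i w x - partial i u x) ^+ 2) / 2 <= 1 - pq.
  move: rcs; rewrite /pq; congr (_ + _ / 2 <= 1 - _).
    by apply: eq_bigr => i _; rewrite !mxE.
  by apply: eq_bigr => i _; rewrite !mxE.
rewrite /K QE qq /volume_density -mulr_suml.
have gb : lorentz_factor u x * Num.sqrt (1 - euclid_norm (grad u x) ^+ 2) = 1.
  by rewrite mulVf// gt_eqF// sqrtr_gt0 euclid_norm_lt1.
exact: gap_algebra gb rcs' g0 (expR_gt0 _).
Qed.

Lemma integrable_density_w : leb.-integrable Omega (EFin \o volume_density w).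
Proof.
have [Mw wM] := graph_bounded w_bounded.
by apply: volume_density_integrable wM => //; exact: loclip_admissible.
Qed.

Lemma integrable_density_u : leb.-integrable Omega (EFin \o volume_density u).
Proof.
have [Mu uM] := solution_bounded oO bO u_smooth.
apply: volume_density_integrable uM => // x.
exact: (loclip_solution oO u_smooth).
Qed.

(** Integrating the nonnegative gap K gives the difference of the volumes; if
    this is 0 then K is 0 almost everywhere, and so is its quadratic lower
    bound. *)
Lemma calibration_comparison :
  (weighted_volume Omega w <= weighted_volume Omega u)%E /\
  (weighted_volume Omega w = weighted_volume Omega u ->
   {ae leb, forall x, Omega x -> forall i, partial i w x = partial i u x}).
Proof.
have F := ae_filter_ringOfSetsType leb.
have [Qi Q0] := calibration_flux.
have wi := integrable_density_w; have ui := integrable_density_u.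
have wui : leb.-integrable Omega
    (EFin \o (fun x => volume_density w x - volume_density u x)).
  rewrite (_ : _ \o _ =
    ((EFin \o volume_density w) \- (EFin \o volume_density u))%E)//.
  exact: (integrableB mO wi ui).
have Ki : leb.-integrable Omega (EFin \o K).
  rewrite (_ : _ \o _ = ((EFin \o Q) \-
    (EFin \o (fun x => (volume_density w x - volume_density u x)%R)))%E)//.
  exact: (integrableB mO Qi wui).
have K0 : {ae leb, forall x, Omega x -> 0 <= K x}.
  apply: filterS calibration_gap => x gx Ox; apply: le_trans (gx Ox).
  rewrite mulr_ge0 ?mulr_ge0 ?expR_ge0//.
    exact: ltW (lorentz_factor_gt0 u_spacelike Ox).
  by apply: sumr_ge0 => i _; rewrite divr_ge0// sqr_ge0.
have mK : measurable_fun Omega (EFin \o K) by case/integrableP: Ki.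
have wf : weighted_volume Omega w \is a fin_num.
  exact: (integrable_fin_num mO wi).
have uf : weighted_volume Omega u \is a fin_num.
  exact: (integrable_fin_num mO ui).
have KE : (\int[leb]_(x in Omega) `|(EFin \o K) x| =
    - (weighted_volume Omega w - weighted_volume Omega u))%E.
  transitivity (\int[leb]_(x in Omega) (EFin \o K) x)%E.
    apply: ae_eq_integral => //; first exact: measurableT_comp.
    by apply: filterS K0 => x Kx Ox; rewrite /= ger0_norm// Kx.
  transitivity (\int[leb]_(x in Omega) ((Q x)%:E -
      (volume_density w x - volume_density u x)%R%:E))%E.
    by apply: eq_integral.
  rewrite integralB_EFin// Q0 sub0e.
  transitivity (- \int[leb]_(x in Omega) ((volume_density w x)%:E -
      (volume_density u x)%:E))%E.
    by congr (- _)%E; apply: eq_integral => x _; rewrite EFinB.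
  by rewrite (integralB_EFin mO wi ui).
have [le eq0] := ereal_gap wf uf KE (integral_ge0 _ (fun _ _ => abse_ge0 _)).
split; [exact: le|move=> wu].
have /(ae_eq_integral_abs leb mO mK) Kz := eq0 wu.
clear wu eq0 le KE wf uf.
apply: filterS2 Kz calibration_gap => x Kx gx Ox i.
have := gx Ox; have [->] := Kx Ox.
rewrite pmulr_rle0; last first.
  by rewrite mulr_gt0 ?expR_gt0 ?(lorentz_factor_gt0 u_spacelike Ox).
move=> S0.
have /eqP : \sum_i (partial i w x - partial i u x) ^+ 2 / 2 = 0.
  apply/eqP; rewrite eq_le S0 sumr_ge0// => j _.
  by rewrite divr_ge0// sqr_ge0.
rewrite psumr_eq0; last by move=> j _; rewrite divr_ge0// sqr_ge0.
move=> /allP/(_ i (mem_index_enum _)) /=.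
by rewrite mulf_eq0 invr_eq0 pnatr_eq0 orbF sqrf_eq0 subr_eq0 => /eqP.
Qed.

(** The difference w - u tends to 0 at the boundary and its gradient vanishes
    almost everywhere. *)
Lemma equality_case (i0 : 'I_n) :
  {ae leb, forall x, Omega x -> forall i, partial i w x = partial i u x} ->
  forall x, Omega x -> w x = u x.
Proof.
move=> wu x Ox; apply/eqP; rewrite -subr_eq0; apply/eqP.
have [Mw wM] := graph_bounded w_bounded.
have [Mu uM] := solution_bounded oO bO u_smooth.
have F := ae_filter_ringOfSetsType leb.
apply: (@vanishing_gradient R n Omega oO bO (fun y => w y - u y) (Mw + Mu) i0) => //.
- move=> y Oy; apply: loclipB; first exact: loclip_admissible.
  exact: (loclip_solution oO u_smooth).
- by move=> y Oy; rewrite (le_trans (ler_normB _ _))// lerD// ?wM ?uM.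
- move=> y by_; have [_ wb] := w_adm; have [_ _ ub] := u_smooth.
  by rewrite -(subrr (u y)); apply: cvgB; [exact: wb|exact: ub].
apply: filterS2 admissible_ae wu => y wy wuy Oy i.
have [_ dw] := wy Oy; have du := derivable_solution u_smooth (i := i) Oy.
rewrite /partial (deriveB (dw i) du); have := wuy Oy i; rewrite /partial => ->.
exact: subrr.
Qed.

End calibration.

Lemma weighted_volume_eq (R : realType) (n : nat) (Omega : set 'rV[R]_n)
    (u w : 'rV[R]_n -> R) : open Omega -> (forall x, Omega x -> w x = u x) ->
  weighted_volume Omega w = weighted_volume Omega u.
Proof.
move=> oO wu; apply: eq_integral => x /set_mem Ox.
have near : \forall y \near x, w y = u y.
  by apply: filterS (open_nbhs_nbhs (conj oO Ox)) => y; exact: wu.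
have gE : grad w x = grad u x.
  by apply/rowP => i; rewrite !mxE; exact: near_eq_derive.
by rewrite (wu x Ox) gE.
Qed.

Unset Implicit Arguments.

Theorem theorem2p1 (R : realType) (n : nat) (n_ge2 : (2 <= n)%N)
    (Omega : set 'rV[R]_n) (u : 'rV[R]_n -> R)
    (Omega_dom : bounded_domain Omega)
    (u_smooth : smooth_on_closure Omega u)
    (u_spacelike : forall x : 'rV[R]_n, closure Omega x ->
       euclid_norm (extension Omega (grad u) x) < 1)
    (u_eq : forall x : 'rV[R]_n, closure Omega x ->
       extension Omega
         (divergence (fun y =>
            (Num.sqrt (1 - euclid_norm (grad u y) ^+ 2))^-1 *: grad u y)) x
       = (Num.sqrt (1 - euclid_norm (extension Omega (grad u) x) ^+ 2))^-1)
    (w : 'rV[R]_n -> R)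
    (w_adm : admissible u Omega w)
    (w_bounded : bounded_set (graph Omega w)) :
  (weighted_volume Omega w <= weighted_volume Omega u)%E /\
  (weighted_volume Omega w = weighted_volume Omega u <->
   graph Omega w = graph Omega u).
Proof.
have [oO _ _ bO] := Omega_dom.
have [le eq] :=
  calibration_comparison oO bO u_smooth u_spacelike u_eq w_adm w_bounded.
split; first exact: le.
split => [/eq wu|gr].
  have i0 : 'I_n by case: (n) n_ge2 => // m _; exact: ord0.
  have {}wu := equality_case oO bO u_smooth w_adm w_bounded i0 wu.
  by apply/seteqP; split => -[x t] [/= Ox tE]; split => //=; rewrite tE wu.
apply: (weighted_volume_eq oO) => x Ox.
have : graph Omega w (x, w x) by [].
by rewrite gr => -[].
Qed.
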